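(* The set \[ \left\{ \frac{\varphi(p+1)}{\varphi(p)} \,:\, p \text{ prime} \right\} \] is dense in $\left[0,\tfrac{1}{2}\right]$.
   Context: $\varphi$ denotes Euler's totient function. This statement is unconditional. *)

(* Defs.v *)
From mathcomp Require Import all_boot all_order all_algebra.
From mathcomp Require Export reals.
Set Implicit Arguments. Unset Strict Implicit. Unset Printing Implicit Defensive.
Import Order.TTheory GRing.Theory Num.Theory.
Local Open Scope ring_scope.

Definition totient_ratio (R : realType) (p : nat) : R :=
  (totient p.+1)%:R / (totient p)%:R.

(* Main.v *)
(* The idea: phi(p+1)/(p+1) is the product of (1 - 1/q) over the primes q dividing
   p + 1.  Choose y0 large and let S consist of 2 and of the primes in (y0, j]; since
   the sum of 1/q diverges and each factor is close to 1, the product over S comes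
   close to any prescribed point of [0, 1/2].  For y >= j the primes p with
   p = -1 mod q for q in S and p = 1 mod q for the other primes q <= y form a residue
   class a modulo M, and it remains to find one for which the sum of 1/q over the
   primes q > y dividing p + 1 is small.  This is done by averaging with weights
   ln p / p over (2^J, 4^J].  For q up to a constant, Dirichlet's theorem modulo M q
   in the quantitative form sum_(p <= N, p = a mod m) ln p / p = ln N / phi(m) + O(1)
   is used; for larger q <= J^2 an upper bound of the right order from Selberg's
   sieve; and p + 1 has too few prime divisors q > J^2 to matter.

   Dirichlet's theorem is proved with real functions on G = (Z/m)^* instead of complex
   characters.  Let l be the function on G whose convolution operator sends f with
   sum 0 to d |-> sum_k f(dk)/k.  Modulo O(1), the sum of Lambda(n) f(n) / n over
   n <= N vanishes on the image of that operator (for f of sum 0), and is - f(1) ln N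
   on its kernel.  The operator is normal, so delta_1 is the sum of an element k of
   the kernel and one of the image, and nonnegativity of Lambda gives k(1) <= 1/|G|.
   If k is not 0 this forces |G| k to be a real character whose L-series vanishes at
   1, which Monsky's Lambert series argument excludes. *)
From HB Require Import structures.
Require Import Defs.
From mathcomp Require Import all_boot all_order all_algebra all_fingroup.
From mathcomp Require Import reals.
From mathcomp Require Import boolp classical_sets exp.
From mathcomp Require Import zify ring lra.
Set Implicit Arguments.
Unset Strict Implicit.
Unset Printing Implicit Defensive.
Import Order.TTheory GRing.Theory Num.Theory.
Local Open Scope ring_scope.

(** * Sums over divisors *)

(** Splitting off the full power of the least prime factor leaves a smaller cofactor prime to it.
    Multiplicative identities below are proved by this induction. *)
Lemma pfactor_ind (P : nat -> Prop) :
  P 1%N ->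
  (forall p e n, prime p -> (0 < e)%N -> (0 < n)%N -> ~~ (p %| n)%N -> P n ->
     P (p ^ e * n)%N) ->
  forall n, (0 < n)%N -> P n.
Proof.
move=> P1 PM n; elim/ltn_ind: n => n IH n_gt0.
have [n_le1 | n_gt1] := leqP n 1; first by have -> : n = 1%N by lia.
have p_pr := pdiv_prime n_gt1; set p := pdiv n in p_pr.
have [m p_m def_n] := pfactor_coprime p_pr n_gt0.
have e_gt0 : (0 < logn p n)%N by rewrite logn_gt0 mem_primes p_pr n_gt0 pdiv_dvd.
have m_gt0 : (0 < m)%N by move: n_gt0; rewrite {1}def_n muln_gt0 => /andP[].
rewrite def_n mulnC; apply: PM => //; first by rewrite -prime_coprime.
apply: IH => //; rewrite def_n -{1}[m]muln1 ltn_pmul2l //.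
by rewrite -(expn0 p) ltn_exp2l ?prime_gt1.
Qed.

Lemma perm_divisors_pfactor p e n : prime p -> (0 < n)%N -> ~~ (p %| n)%N ->
  perm_eq (divisors (p ^ e * n))
          [seq (p ^ i * d)%N | i <- iota 0 e.+1, d <- divisors n].
Proof.
move=> p_pr n_gt0 p_n.
have p_gt0 := prime_gt0 p_pr.
have pd d : d \in divisors n -> ~~ (p %| d)%N.
  by rewrite -dvdn_divisors // => d_n; apply: contra p_n => /dvdn_trans; apply.
have pen_gt0 : (0 < p ^ e * n)%N by rewrite muln_gt0 expn_gt0 p_gt0.
apply: uniq_perm; first exact: divisors_uniq.
  apply: allpairs_uniq => [||x1 x2 /allpairsP[[i1 d1] [_ d_n ->]]
      /allpairsP[[j1 d2] [_ d'_n ->]]].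
  - exact: iota_uniq.
  - exact: divisors_uniq.
  rewrite /= in d_n d'_n *.
  have d_gt0 : (0 < d1)%N by move: d_n; rewrite -dvdn_divisors // => /dvdn_gt0; apply.
  have d'_gt0 : (0 < d2)%N by move: d'_n; rewrite -dvdn_divisors // => /dvdn_gt0; apply.
  move=> eq_id.
  have logE k x : (0 < x)%N -> ~~ (p %| x)%N -> logn p (p ^ k * x) = k.
    move=> x_gt0 px; rewrite lognM ?expn_gt0 ?p_gt0 // pfactorK //.
    by rewrite lognE p_pr x_gt0 (negPf px) addn0.
  have eq_ij : i1 = j1.
    by rewrite -(logE i1 d1) ?pd // eq_id logE ?pd.
  by move: eq_id; rewrite eq_ij => /eqP; rewrite eqn_pmul2l ?expn_gt0 ?p_gt0 // => /eqP->.
move=> x; rewrite -dvdn_divisors //; apply/idP/allpairsP.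
  move=> x_pen; have x_gt0 := dvdn_gt0 pen_gt0 x_pen.
  have [m p_m def_x] := pfactor_coprime p_pr x_gt0.
  exists (logn p x, m); split; last by rewrite /= mulnC.
    rewrite mem_iota [(_, _).1]/= add0n leq0n ltnS.
    have : (p ^ logn p x %| p ^ e * n)%N by apply: dvdn_trans x_pen; rewrite pfactor_dvdn.
    by rewrite Gauss_dvdl ?coprimeXl ?prime_coprime // dvdn_Pexp2l ?prime_gt1.
  rewrite -dvdn_divisors // [(_, _).2]/=.
  have : (m %| p ^ e * n)%N by apply: dvdn_trans x_pen; rewrite def_x dvdn_mulr.
  by rewrite Gauss_dvdr // coprime_sym coprimeXl.
move=> [[i d] [i_e d_n ->]]; apply: dvdn_mul; last by rewrite dvdn_divisors.
by apply: dvdn_exp2l; move: i_e; rewrite mem_iota; lia.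
Qed.

Lemma sum_divisors_pfactor (V : nmodType) p e n (F : nat -> V) :
  prime p -> (0 < n)%N -> ~~ (p %| n)%N ->
  \sum_(d <- divisors (p ^ e * n)) F d =
  \sum_(i < e.+1) \sum_(d <- divisors n) F (p ^ i * d)%N.
Proof.
move=> p_pr n_gt0 p_n; have eq_div := perm_divisors_pfactor e p_pr n_gt0 p_n.
by rewrite (perm_big _ eq_div) big_allpairs_dep -[iota 0 _]/(index_iota 0 e.+1) big_mkord.
Qed.

Lemma sum_divisors_nat (V : nmodType) N n (F : nat -> V) : (0 < n <= N)%N ->
  \sum_(d <- divisors n) F d = \sum_(1 <= d < N.+1 | (d %| n)%N) F d.
Proof.
move=> /andP[n_gt0 n_N]; rewrite -[RHS]big_filter; apply: perm_big.
apply: uniq_perm; rewrite ?divisors_uniq ?filter_uniq ?iota_uniq // => d.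
rewrite mem_filter mem_index_iota -dvdn_divisors //.
by case d_n: (d %| n)%N => //=; have := dvdn_leq n_gt0 d_n; have := dvdn_gt0 n_gt0 d_n; lia.
Qed.

Lemma sum_multiples (V : nmodType) N d (F : nat -> V) : (0 < d)%N ->
  \sum_(1 <= n < N.+1 | (d %| n)%N) F n = \sum_(1 <= k < (N %/ d).+1) F (d * k)%N.
Proof.
move=> d_gt0; elim: N => [|N IH]; first by rewrite div0n !big_geq.
rewrite big_mkcond big_nat_recr //= -big_mkcond IH divnS //.
case: (boolP (d %| N.+1)%N) => [d_N|_]; last by rewrite addr0.
rewrite add1n [RHS]big_nat_recr //=; congr (_ + F _).
by rewrite -{1}(divnK d_N) mulnC divnS // d_N.
Qed.

(** Both sides run over the pairs (d, k) with d k <= N, grouped by the product on the left and by d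
    on the right. *)
Lemma sum_hyperbola (V : nmodType) N (F : nat -> nat -> V) :
  \sum_(1 <= n < N.+1) \sum_(d <- divisors n) F d (n %/ d)%N =
  \sum_(1 <= d < N.+1) \sum_(1 <= k < (N %/ d).+1) F d k.
Proof.
under eq_big_nat => n hn do rewrite (@sum_divisors_nat _ N) // big_mkcond.
rewrite exchange_big_nat /=; apply: eq_big_nat => d /andP[d_gt0 _].
rewrite -big_mkcond sum_multiples //; apply: eq_bigr => k _; by rewrite mulKn.
Qed.

Lemma sum_totient n : (0 < n)%N -> (\sum_(d <- divisors n) totient d)%N = n.
Proof.
move: n; apply: pfactor_ind => [|p e n p_pr e_gt0 n_gt0 p_n IH].
  by rewrite big_seq1.
rewrite [LHS](sum_divisors_pfactor e totient p_pr n_gt0 p_n).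
have p_gt0 := prime_gt0 p_pr.
rewrite (eq_bigr (fun i : 'I_e.+1 => totient (p ^ i) * n)%N); last first.
  move=> i _; rewrite -[in RHS]IH big_distrr /=; apply: eq_big_seq => d.
  rewrite -dvdn_divisors // => d_n; rewrite totient_coprime // coprimeXl // prime_coprime //.
  by apply: contra p_n => /dvdn_trans; apply.
rewrite -big_distrl /=; congr (_ * _)%N.
elim: e {e_gt0 } => [|e IHe]; first by rewrite big_ord1.
rewrite big_ord_recr /= IHe totient_pfactor // expnS.
by case: (p) p_gt0 => // q _; rewrite mulSn.
Qed.

(** * The Moebius and von Mangoldt functions *)

Lemma perm_primesM a b : (0 < a)%N -> (0 < b)%N -> coprime a b ->
  perm_eq (primes (a * b)) (primes a ++ primes b).
Proof.
move=> a_gt0 b_gt0 co_ab; apply: uniq_perm; first exact: primes_uniq.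
  by rewrite cat_uniq !primes_uniq -coprime_has_primes // co_ab.
by move=> p; rewrite mem_cat primesM.
Qed.

Definition squarefree n := all (fun p => logn p n <= 1)%N (primes n).

Lemma squarefreeM a b : (0 < a)%N -> (0 < b)%N -> coprime a b ->
  squarefree (a * b) = squarefree a && squarefree b.
Proof.
move=> a_gt0 b_gt0 co_ab; rewrite /squarefree (perm_all _ (perm_primesM a_gt0 b_gt0 co_ab)).
rewrite all_cat; congr (_ && _); apply: eq_in_all => p p_in; rewrite lognM //.
  suff -> : logn p b = 0%N by rewrite addn0.
  by rewrite lognE; case: ifP => // /and3P[p_pr _ p_b]; move: p_in co_ab;
    rewrite mem_primes => /and3P[_ _ p_a]; rewrite /coprime => /eqP g1;
    have := dvdn_gcd p a b; rewrite p_a p_b g1 dvdn1 => /eqP p1; rewrite p1 in p_pr.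
suff -> : logn p a = 0%N by rewrite add0n.
by rewrite lognE; case: ifP => // /and3P[p_pr _ p_a]; move: p_in co_ab;
  rewrite mem_primes => /and3P[_ _ p_b]; rewrite /coprime => /eqP g1;
  have := dvdn_gcd p a b; rewrite p_a p_b g1 dvdn1 => /eqP p1; rewrite p1 in p_pr.
Qed.

Lemma squarefree_dvd d n : (0 < n)%N -> (d %| n)%N -> squarefree n -> squarefree d.
Proof.
move=> n_gt0 d_n /allP sq_n; apply/allP => p p_d.
have d_gt0 := dvdn_gt0 n_gt0 d_n.
apply: leq_trans (dvdn_leq_log p n_gt0 d_n) (sq_n _ _).
by move: p_d; rewrite !mem_primes n_gt0 d_gt0 => /and3P[-> _ /dvdn_trans->].
Qed.

Lemma squarefree_coprime a b : (0 < a * b)%N -> squarefree (a * b) -> coprime a b.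
Proof.
rewrite muln_gt0 => /andP[a_gt0 b_gt0] /allP sq; rewrite coprime_has_primes //.
apply/hasPn => p p_b; apply/negP => /= p_a.
have := sq p; rewrite primesM // p_a lognM // => /(_ isT).
move: p_a p_b; rewrite -!logn_gt0; lia.
Qed.

Lemma pfactor_eq1F p e n : prime p -> (0 < e)%N -> (p ^ e * n == 1)%N = false.
Proof.
move=> p_pr e_gt0; rewrite muln_eq1; have : (1 < p ^ e)%N.
  by rewrite -(expn0 p) ltn_exp2l ?prime_gt1.
by case: eqP => // ->.
Qed.

Section Moebius.
Variable R : realType.

Definition moebius n : R := if squarefree n then (-1) ^+ size (primes n) else 0.

Lemma moebius1 : moebius 1 = 1. Proof. by []. Qed.

Lemma moebiusM a b : (0 < a)%N -> (0 < b)%N -> coprime a b ->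
  moebius (a * b) = moebius a * moebius b.
Proof.
move=> a_gt0 b_gt0 co_ab; rewrite /moebius squarefreeM //.
rewrite (perm_size (perm_primesM a_gt0 b_gt0 co_ab)) size_cat exprD.
by do 2!case: squarefree; rewrite /= ?mulr0 ?mul0r.
Qed.

Lemma moebius_prime p : prime p -> moebius p = -1.
Proof.
move=> p_pr; rewrite /moebius /squarefree primes_prime //= andbT.
by rewrite logn_prime // eqxx.
Qed.

Lemma moebius_pfactor p e : prime p -> moebius (p ^ e.+2) = 0.
Proof.
move=> p_pr; rewrite /moebius /squarefree primesX // primes_prime //= andbT.
by rewrite pfactorK.
Qed.

Lemma norm_moebius n : `|moebius n| <= 1.
Proof. by rewrite /moebius; case: ifP => _; [rewrite normrX normrN1 expr1n|rewrite normr0]. Qed.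

Lemma sqr_moebius n : squarefree n -> moebius n ^+ 2 = 1.
Proof. by rewrite /moebius => ->; rewrite -exprM mulnC exprM sqrrN !expr1n. Qed.

(** Divisors containing p^2 have mu = 0, so only the exponents 0 and 1 of p survive, and mu(p d) = -
    mu(d). *)
Lemma sum_moebius_pfactor p e n (F : nat -> R) :
  prime p -> (0 < n)%N -> ~~ (p %| n)%N -> (0 < e)%N ->
  \sum_(d <- divisors (p ^ e * n)) moebius d * F d =
  \sum_(d <- divisors n) moebius d * (F d - F (p * d)%N).
Proof.
move=> p_pr n_gt0 p_n; case: e => // e _; rewrite sum_divisors_pfactor //.
have pd d : d \in divisors n -> (0 < d)%N /\ ~~ (p %| d)%N.
  rewrite -dvdn_divisors // => d_n; split; first exact: dvdn_gt0 d_n.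
  by apply: contra p_n => /dvdn_trans; apply.
rewrite big_ord_recl big_ord_recl /= [X in _ + (_ + X)]big1 ?addr0; last first.
  move=> i _; apply: big1_seq => d /pd[d_gt0 p_d].
  rewrite moebiusM ?expn_gt0 ?(prime_gt0 p_pr) //; last by apply: coprimeXl;
    rewrite prime_coprime.
  by rewrite moebius_pfactor // !mul0r.
rewrite -big_split /= big_seq [RHS]big_seq; apply: eq_bigr => d /pd[d_gt0 p_d].
rewrite expn0 mul1n [bump 0 0]/= expn1 (moebiusM (prime_gt0 p_pr) d_gt0) ?prime_coprime //
  (moebius_prime p_pr) mulN1r mulNr mulrBr //.
Qed.

Lemma sum_moebius n : (0 < n)%N ->
  \sum_(d <- divisors n) moebius d = (n == 1%N)%:R.
Proof.
move: n; apply: pfactor_ind => [|p e n p_pr e_gt0 n_gt0 p_n _].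
  by rewrite big_seq1 moebius1.
under eq_bigr do rewrite -[moebius _]mulr1.
rewrite (sum_moebius_pfactor (fun=> 1)) // big1 => [|d _]; last by rewrite subrr mulr0.
by rewrite pfactor_eq1F.
Qed.

(** If l = f g, then g is prime to f since l is squarefree; the divisors in question are f e with e
    | g, and the sum of mu over the divisors of g vanishes unless g = 1. This inverts the linear
    system of Selberg's sieve. *)
Lemma sum_moebius_above f l : (0 < l)%N -> squarefree l ->
  \sum_(d <- divisors l | (f %| d)%N) moebius d = moebius f * (f == l)%:R.
Proof.
move=> l_gt0 sq_l; have [f_l|f_l] := boolP (f %| l)%N; last first.
  rewrite big1_seq; first by case: eqP f_l => [->|]; rewrite ?dvdnn // mulr0.
  by move=> d /andP[f_d]; rewrite -dvdn_divisors // => /(dvdn_trans f_d) h; rewrite h in f_l.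
have f_gt0 := dvdn_gt0 l_gt0 f_l.
have [g def_l] := dvdnP f_l; rewrite mulnC in def_l.
have g_gt0 : (0 < g)%N by move: l_gt0; rewrite def_l muln_gt0 => /andP[].
have co_fg : coprime f g by apply: squarefree_coprime; rewrite -?def_l.
have eq_div : perm_eq [seq d <- divisors l | (f %| d)%N] [seq (f * e)%N | e <- divisors g].
  apply: uniq_perm; rewrite ?filter_uniq ?divisors_uniq // ?map_inj_uniq ?divisors_uniq //.
    by move=> x y /eqP; rewrite eqn_pmul2l // => /eqP.
  move=> d; rewrite mem_filter -dvdn_divisors //; apply/andP/mapP.
    move=> [/dvdnP[e ->]] e_l; exists e; last by rewrite mulnC.
    by rewrite -dvdn_divisors // -(dvdn_pmul2l f_gt0) -def_l mulnC.
  move=> [e]; rewrite -dvdn_divisors // => e_g ->.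
  by rewrite def_l dvdn_mulr // dvdn_pmul2l.
rewrite -big_filter (perm_big _ eq_div) big_map big_seq.
under eq_bigr => e e_g.
  have e_g' : (e %| g)%N by rewrite dvdn_divisors.
  rewrite moebiusM // ?(dvdn_gt0 g_gt0 e_g') // ?(coprime_dvdr e_g' co_fg) //.
over.
rewrite -big_seq -mulr_sumr sum_moebius // def_l.
by rewrite -[X in _ = _ * (X == _)%:R]muln1 eqn_pmul2l // eq_sym.
Qed.

(** A singleton [primes n] means that n is a positive power of that prime. *)
Definition vonmangoldt n : R := if primes n is [:: p] then ln p%:R else 0.

Lemma vonmangoldt_prime p : prime p -> vonmangoldt p = ln p%:R.
Proof. by move=> p_pr; rewrite /vonmangoldt primes_prime. Qed.

Lemma vonmangoldt_ge0 n : 0 <= vonmangoldt n.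
Proof.
rewrite /vonmangoldt; case E: (primes n) => [|p [|]] //.
have : p \in primes n by rewrite E mem_head.
by rewrite mem_primes => /and3P[p_pr _ _]; rewrite ln_ge0 // ler1n prime_gt0.
Qed.

Lemma vonmangoldt_pfactor p e n : prime p -> (0 < n)%N -> ~~ (p %| n)%N ->
  vonmangoldt (p ^ e.+1 * n) = (n == 1%N)%:R * ln p%:R.
Proof.
move=> p_pr n_gt0 p_n; case: eqP => [->|n_neq1].
  by rewrite muln1 mul1r /vonmangoldt primesX // primes_prime.
have n_gt1 : (1 < n)%N by lia.
have : perm_eq (primes (p ^ e.+1 * n)) (p :: primes n).
  have -> : p :: primes n = primes (p ^ e.+1) ++ primes n.
    by rewrite primesX // (primes_prime p_pr).
  by apply: perm_primesM; rewrite ?expn_gt0 ?(prime_gt0 p_pr) ?coprimeXl ?prime_coprime.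
move=> /perm_size /=; rewrite mul0r /vonmangoldt.
have : pdiv n \in primes n by rewrite mem_primes pdiv_prime // n_gt0 pdiv_dvd.
by case: (primes n) => // q s _; case: (primes _) => // q1 [|].
Qed.

Lemma ln_natM a b : (0 < a)%N -> (0 < b)%N ->
  ln (a * b)%:R = ln a%:R + ln b%:R :> R.
Proof. by move=> ha hb; rewrite natrM lnM // posrE ltr0n. Qed.

Lemma sum_vonmangoldt n : (0 < n)%N ->
  \sum_(d <- divisors n) vonmangoldt d = ln n%:R.
Proof.
move: n; apply: pfactor_ind => [|p e n p_pr e_gt0 n_gt0 p_n IH].
  by rewrite big_seq1 ln1.
rewrite sum_divisors_pfactor // big_ord_recl /=.
under [X in X + _]eq_bigr do rewrite expn0 mul1n.
rewrite IH ln_natM ?expn_gt0 ?(prime_gt0 p_pr) // addrC; congr (_ + _).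
rewrite natrX lnXn ?ltr0n ?prime_gt0 //.
rewrite (eq_bigr (fun=> ln p%:R)) ?sumr_const ?card_ord // => i _.
rewrite (bigD1_seq 1%N) ?divisors_uniq ?divisor1 //= vonmangoldt_pfactor //; last first.
  by rewrite dvdn1; case: eqP p_pr => // ->.
rewrite eqxx mul1r big1_seq ?addr0 // => d /andP[d_neq1].
rewrite -dvdn_divisors // => d_n; rewrite vonmangoldt_pfactor ?(dvdn_gt0 n_gt0 d_n) //.
  by rewrite (negPf d_neq1) mul0r.
by apply: contra p_n => /dvdn_trans; apply.
Qed.

Lemma vonmangoldt_le_ln n : (0 < n)%N -> vonmangoldt n <= ln n%:R.
Proof.
move=> n_gt0; rewrite -sum_vonmangoldt // (bigD1_seq n) ?divisors_uniq ?divisors_id //=.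
by rewrite lerDl sumr_ge0 // => d _; exact: vonmangoldt_ge0.
Qed.

(** Pairing d with p d cancels x and leaves the constant ln p, so only n a power of p survives. The
    free x becomes ln N later, which makes the weights x - ln d nonnegative for d <= N. *)
Lemma sum_moebius_ln n (x : R) : (0 < n)%N ->
  \sum_(d <- divisors n) moebius d * (x - ln d%:R) =
  vonmangoldt n + (n == 1%N)%:R * x.
Proof.
move: n; apply: pfactor_ind => [|p e n p_pr e_gt0 n_gt0 p_n _].
  by rewrite big_seq1 moebius1 ln1 /vonmangoldt /=; ring.
rewrite (sum_moebius_pfactor (fun d => x - ln d%:R)) // big_seq.
under eq_bigr => d d_n.
  have d_gt0 : (0 < d)%N by move: d_n; rewrite -dvdn_divisors //; apply: dvdn_gt0.
  rewrite ln_natM ?(prime_gt0 p_pr) //.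
  rewrite (_ : _ - _ = ln p%:R); last by ring.
over.
rewrite -big_seq -mulr_suml sum_moebius // -(prednK e_gt0) vonmangoldt_pfactor //.
by rewrite pfactor_eq1F // mul0r addr0.
Qed.

End Moebius.

(** * Bounds for sums and logarithms *)

Section RealBounds.
Variable R : realType.
Implicit Types (F w u e : nat -> R).

(** Group the nonnegative terms [H j] by the value [h j]: each group over an i in r contains a term
    at least [F i]. No bijection has to be exhibited. *)
Lemma ler_sum_onto (I J : eqType) (r : seq I) (s : seq J) (F : I -> R) (H : J -> R)
    (h : J -> I) : uniq r -> (forall j, j \in s -> 0 <= H j) ->
  (forall i, i \in r -> exists2 j, j \in s & h j = i /\ F i <= H j) ->
  \sum_(i <- r) F i <= \sum_(j <- s) H j.
Proof.
move=> r_uniq H_ge0 onto.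
have -> : \sum_(j <- s) H j = \sum_(j <- s | j \in s) H j by rewrite -big_seq.
apply: (@le_trans _ _ (\sum_(j <- s | j \in s) \sum_(i <- r | i == h j) H j)); last first.
  apply: ler_sum => j /H_ge0 Hj_ge0; case: (boolP (h j \in r)) => [hj_r|hj_r].
    by rewrite -big_filter (filter_pred1_uniq r_uniq hj_r) big_seq1.
  by rewrite big1_seq // => i /andP[/eqP-> hj]; rewrite hj in hj_r.
rewrite (exchange_big_dep xpredT) //= big_seq [leRHS]big_seq; apply: ler_sum => i i_r.
have [j j_s [def_i Fi_le]] := onto i i_r.
apply: (le_trans Fi_le); rewrite (perm_big _ (perm_to_rem j_s)) /=.
rewrite big_cons j_s def_i eqxx /= lerDl; apply: sumr_ge0 => k /andP[ks _]; exact: H_ge0.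
Qed.

Lemma abel_summation F w B a b : (a <= b)%N -> 0 <= B ->
  (forall c, `|\sum_(a <= i < c) F i| <= B) ->
  (forall i, (a <= i)%N -> w i.+1 <= w i) -> (forall i, (a <= i)%N -> 0 <= w i) ->
  `|\sum_(a <= i < b) F i * w i| <= B * w a.
Proof.
move=> a_b B_ge0 F_B w_dec w_ge0; case: (ltngtP a b) a_b => // [a_b _|<- _]; last first.
  by rewrite big_geq // normr0 mulr_ge0 // w_ge0.
(* Summation by parts: the boundary term is subtracted first, so that the remaining differences of w
   telescope. *)
suff IH k : `|\sum_(a <= i < (a + k).+1) F i * w i - (\sum_(a
  <= i < (a + k).+1) F i) * w (a + k)%N|
    <= B * (w a - w (a + k)%N).
  have := IH (b - a.+1)%N; have -> : (a + (b - a.+1)).+1 = b by lia.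
  set k := (a + _)%N => IHb; have wk : 0 <= w k by rewrite w_ge0 // leq_addr.
  rewrite -[X in `|X|](subrK ((\sum_(a <= i < b) F i) * w k)).
  apply: le_trans (ler_normD _ _) _; rewrite normrM (ger0_norm wk).
  have := ler_wpM2r wk (F_B b); move: IHb; rewrite mulrBr; lra.
elim: k => [|k IH].
  by rewrite addn0 !big_nat1 !subrr normr0 mulr0.
rewrite addnS big_nat_recr /=; last by lia.
rewrite [X in _ - X * _]big_nat_recr /=; last by lia.
rewrite (_ : _ - _ = \sum_(a <= i < (a + k).+1) F i * w i -
   (\sum_(a <= i < (a + k).+1) F i) * w (a + k)%N +
   (\sum_(a <= i < (a + k).+1) F i) * (w (a + k)%N - w (a + k).+1)); last by ring.
apply: le_trans (ler_normD _ _) _; rewrite normrM.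
have wk : w (a + k).+1 <= w (a + k)%N by rewrite w_dec // leq_addr.
rewrite (ger0_norm (_ : 0 <= w (a + k)%N - _)); last by rewrite subr_ge0.
have := F_B (a + k).+1; rewrite -subr_ge0 in wk.
move=> /(ler_wpM2r wk); move: IH; rewrite !mulrBr; lra.
Qed.

(** The intervals [u K - e K, u K + e K] meet pairwise, so the supremum of their left ends lies in
    all of them. *)
Lemma cauchy_limit u e : (forall K L, `|u K - u L| <= e K + e L) ->
  exists l, forall K, `|u K - l| <= e K.
Proof.
move=> u_cauchy; pose E := [set x | exists K, x = u K - e K]%classic.
have E_ub L : ubound E (u L + e L).
  by move=> _ [K ->]; have := u_cauchy K L; rewrite ler_norml => /andP[]; lra.
exists (sup E) => K; rewrite ler_norml; apply/andP; split.
  suff : sup E <= u K + e K by lra.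
  by apply: ge_sup; [exists (u 0%N - e 0%N), 0%N | apply: E_ub].
suff : u K - e K <= sup E by lra.
by apply: ub_le_sup; [exists (u 0%N + e 0%N); apply: E_ub | exists K].
Qed.

Lemma ln_nat_ge0 n : 0 <= ln n%:R :> R.
Proof. by case: n => [|n]; [rewrite ln0 | rewrite ln_ge0 // ler1n]. Qed.

Lemma ler_ln_nat m n : (0 < m)%N -> (m <= n)%N -> ln m%:R <= ln n%:R :> R.
Proof. by move=> m_gt0 m_n; rewrite ler_ln ?posrE ?ltr0n ?ler_nat //; lia. Qed.

Lemma lnS_ub n : (0 < n)%N -> ln n.+1%:R - ln n%:R <= n%:R^-1 :> R.
Proof.
move=> n_gt0; have n_gt0' : 0 < n%:R :> R by rewrite ltr0n.
rewrite -ln_div ?posrE ?ltr0n // -natr1 mulrDl divff ?gt_eqF // mul1r.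
by apply: le_ln1Dx; rewrite (lt_trans (ltrN10 _)) ?invr_gt0.
Qed.

Lemma lnS_lb n : (0 < n)%N -> n.+1%:R^-1 <= ln n.+1%:R - ln n%:R :> R.
Proof.
move=> n_gt0; rewrite -[leRHS]opprB lerNr -ln_div ?posrE ?ltr0n //.
have -> : n%:R / n.+1%:R = 1 + - n.+1%:R^-1 :> R.
  by rewrite -natr1; field; rewrite natr1 pnatr_eq0.
apply: le_ln1Dx; rewrite ltrN2 invf_lt1 ?ltr0n //.
by rewrite -natr1 ltrDr ltr0n.
Qed.

Lemma ln2_le1 : ln 2%:R <= 1 :> R.
Proof. by have := @lnS_ub 1 isT; rewrite ln1 subr0 invr1. Qed.

Lemma ln2_ge_half : 2^-1 <= ln 2%:R :> R.
Proof. by have := @lnS_lb 1 isT; rewrite ln1 subr0. Qed.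

Lemma ln_pow2 k : ln (2 ^ k)%:R = k%:R * ln 2%:R :> R.
Proof. by rewrite natrX lnXn // mulr_natl. Qed.

(** Passing from N to N + 1 adds N (ln (N + 1) - ln N) <= 1. This does the work of Stirling's
    formula. *)
Lemma sum_ln_ratio N : \sum_(1 <= n < N.+1) (ln N%:R - ln n%:R) <= N%:R :> R.
Proof.
elim: N => [|N IH]; first by rewrite big_geq.
rewrite big_nat_recr //= subrr addr0.
have -> : \sum_(1 <= i < N.+1) (ln N.+1%:R - ln i%:R) =
    \sum_(1 <= i < N.+1) (ln N%:R - ln i%:R) + N%:R * (ln N.+1%:R - ln N%:R) :> R.
  rewrite mulr_natl (_ : (_ - _) *+ N = \sum_(1 <= i < N.+1) (ln N.+1%:R - ln N%:R)).
    rewrite -big_split /=.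
    by apply: eq_bigr => i _; ring.
  by rewrite sumr_const_nat subn1.
suff : N%:R * (ln N.+1%:R - ln N%:R) <= 1 :> R by rewrite -natr1; lra.
case: N {IH} => [|N]; first by rewrite mul0r.
by rewrite mulrC -ler_pdivlMr ?ltr0n // mul1r lnS_ub.
Qed.

Lemma harmonic_lb N : ln N.+1%:R <= \sum_(1 <= n < N.+1) n%:R^-1 :> R.
Proof.
elim: N => [|N IH]; first by rewrite big_geq // ln1.
rewrite big_nat_recr //=; have := @lnS_ub N.+1 isT; rewrite lerBlDl => /le_trans; apply.
by rewrite lerD2r.
Qed.

Lemma ln_nat_unbounded (B : R) : exists2 N, (0 < N)%N & B < ln N%:R.
Proof.
have [k Bk] : exists k, 2 * B < k%:R.
  exists (Num.trunc (2 * B)).+1; exact: truncnS_gt.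
exists (2 ^ k)%N; first by rewrite expn_gt0.
rewrite ln_pow2; have := ler_wpM2l (ler0n R k) ln2_ge_half; lra.
Qed.

End RealBounds.

(** * Chebyshev's and Mertens' estimates *)

Section Mertens.
Variable R : realType.
Local Notation L := (@vonmangoldt R).

(** The terms with d > N vanish; a longer range M lets the expansions for N and 2N be compared term
    by term. *)
Lemma sum_ln_vonmangoldt N M : (N <= M)%N ->
  \sum_(1 <= n < N.+1) ln n%:R = \sum_(1 <= d < M.+1) L d * (N %/ d)%:R.
Proof.
move=> N_M.
rewrite (eq_big_nat _ _ (F2 := fun n => \sum_(d <- divisors n) L d)); last first.
  by move=> n /andP[n_gt0 _]; rewrite sum_vonmangoldt.
rewrite (sum_hyperbola N (fun d _ => L d)) [RHS](big_cat_nat _ (n := N.+1)) //=.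
rewrite [X in _ + X]big1_seq ?addr0; last first.
  move=> d /andP[_]; rewrite mem_index_iota => /andP[N_d _].
  by rewrite divn_small // mulr0.
by apply: eq_bigr => d _; rewrite sumr_const_nat subn1 mulr_natr.
Qed.

Lemma ln_fact N : ln N`!%:R = \sum_(1 <= n < N.+1) ln n%:R :> R.
Proof.
elim: N => [|N IH]; first by rewrite big_geq // ln1.
by rewrite factS ln_natM ?fact_gt0 // big_nat_recr //= IH addrC.
Qed.

Lemma ln_central_binomial N : ln 'C(N.*2, N)%:R <= N.*2%:R :> R.
Proof.
have bin_le : ('C(N.*2, N) <= 2 ^ N.*2)%N.
  rewrite -[2%N]/(1 + 1)%N expnDn (bigD1 (inord N)) //= inordK; last by lia.
  by rewrite !exp1n !muln1 leq_addr.
have bin_gt0 : (0 < 'C(N.*2, N))%N by rewrite bin_gt0; lia.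
apply: (le_trans (ler_ln_nat R bin_gt0 bin_le)).
by rewrite ln_pow2 ler_piMr // ln2_le1.
Qed.

Definition psi N : R := \sum_(1 <= n < N.+1) L n.

(** In the expansion of the logarithm of the central binomial coefficient, Lambda(d) has coefficient
    floor(2N/d) - 2 floor(N/d), which is nonnegative, and at least 1 for N < d <= 2N. *)
Lemma psi_double N : psi N.*2 - psi N <= N.*2%:R.
Proof.
apply: le_trans (ln_central_binomial N).
have -> : ln 'C(N.*2, N)%:R = ln (N.*2)`!%:R - ln N`!%:R *+ 2 :> R.
  have /(bin_fact (n := N.*2)) : (N <= N.*2)%N by lia.
  have -> : (N.*2 - N)%N = N by lia.
  move=> <-; rewrite !ln_natM ?muln_gt0 ?fact_gt0 //; first by rewrite mulr2n; ring.
  by rewrite bin_gt0; lia.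
rewrite !ln_fact (sum_ln_vonmangoldt (leqnn _)) (@sum_ln_vonmangoldt N N.*2); last by lia.
rewrite /psi [X in X - _](big_cat_nat _ (n := N.+1)) //=; last by lia.
rewrite addrAC subrr add0r -sumrMnl -sumrB [leRHS](big_cat_nat _ (n := N.+1)) //=; last by lia.
rewrite -[leLHS]add0r; apply: lerD.
  apply: sumr_ge0 => d _; rewrite -mulrnAr -mulrBr mulr_ge0 ?vonmangoldt_ge0 //.
  rewrite mulr2n -natrD subr_ge0 ler_nat addnn; case: (posnP d) => [->|d_gt0];
    first by rewrite divn0.
  by rewrite leq_divRL // -doubleMl leq_double leq_trunc_div.
rewrite big_seq [leRHS]big_seq; apply: ler_sum => d; rewrite mem_index_iota => /andP[N_d d_N].
rewrite [(N %/ d)%N]divn_small // mulr0 mul0rn subr0.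
by rewrite ler_peMr ?vonmangoldt_ge0 // ler1n divn_gt0; lia.
Qed.

(** Halving N: the doubling estimate gives psi(2k) <= 4k + 2k, and for odd N the last term adds at
    most ln(2k + 1) <= 2k, in total at most 8k. *)
Lemma psi_le N : psi N <= 4 * N%:R.
Proof.
elim/ltn_ind: N => -[|N] IH; first by rewrite /psi big_geq // mulr0.
have [k [b [def_N k_N]]] : exists k b, N.+1 = (nat_of_bool b + k.*2)%N /\ (k < N.+1)%N.
  by exists N.+1./2, (odd N.+1); rewrite odd_double_half; split => //; lia.
have psi_half : psi k.*2 <= 6 * k%:R.
  have := IH _ k_N; have := psi_double k; rewrite -[in X in _ <= X]muln2 natrM; lra.
have k_ge0 := ler0n R k; rewrite def_N; case: b {def_N} => /=; last first.
  by apply: (le_trans psi_half); rewrite add0n -muln2 natrM; lra.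
rewrite add1n /psi big_nat_recr //= -/(psi _).
have Lk : L (k.*2).+1 <= k.*2%:R.
  apply: le_trans (vonmangoldt_le_ln _ _) _ => //.
  rewrite -natr1 addrC; apply: le_ln1Dx.
  by apply: lt_le_trans (ler0n _ _); rewrite ltrN10.
apply: (le_trans (lerD psi_half Lk)).
by rewrite -natr1 -muln2 natrM; lra.
Qed.

(** With S the sum in question, N S exceeds ln N! = sum Lambda(d) floor(N/d) by at least 0 and at
    most psi(N) <= 4N, while N ln N exceeds ln N! by at least 0 and at most N. *)
Lemma mertens N : (0 < N)%N ->
  `|\sum_(1 <= d < N.+1) L d / d%:R - ln N%:R| <= 4.
Proof.
move=> N_gt0; have N_gt0' : 0 < N%:R :> R by rewrite ltr0n.
have sum_eq : N%:R * ln N%:R - \sum_(1 <= n < N.+1) ln n%:R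
    = \sum_(1 <= n < N.+1) (ln N%:R - ln n%:R) :> R.
  by rewrite sumrB sumr_const_nat subn1 mulr_natl.
have ub := sum_ln_ratio R N.
have lb : 0 <= \sum_(1 <= n < N.+1) (ln N%:R - ln n%:R) :> R.
  rewrite big_seq sumr_ge0 // => n; rewrite mem_index_iota => /andP[n_gt0 n_N].
  by rewrite subr_ge0 ler_ln_nat.
have div_bounds d : (0 < d)%N -> (N%:R / d%:R - 1 : R) <= (N %/ d)%:R <= (N%:R / d%:R : R).
  move=> d_gt0; have d_gt0' : 0 < d%:R :> R by rewrite ltr0n.
  apply/andP; split.
    by rewrite lerBlDr ler_pdivrMr // natr1 -natrM ler_nat ltnW // ltn_ceil.
  by rewrite ler_pdivlMr // -natrM ler_nat leq_trunc_div.
have ub2 : \sum_(1 <= n < N.+1) ln n%:R <= N%:R * \sum_(1 <= d < N.+1) L d / d%:R.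
  rewrite (sum_ln_vonmangoldt (leqnn N)) mulr_sumr big_seq [leRHS]big_seq.
  apply: ler_sum => d; rewrite mem_index_iota => /andP[d_gt0 _].
  rewrite mulrCA ler_wpM2l ?vonmangoldt_ge0 //; by case/andP: (div_bounds d d_gt0).
have lb2 : N%:R * (\sum_(1 <= d < N.+1) L d / d%:R) - psi N <= \sum_(1 <= n < N.+1) ln n%:R.
  rewrite (sum_ln_vonmangoldt (leqnn N)) mulr_sumr /psi -sumrB big_seq [leRHS]big_seq.
  apply: ler_sum => d; rewrite mem_index_iota => /andP[d_gt0 _].
  rewrite mulrCA -[X in _ - X]mulr1 -mulrBr ler_wpM2l ?vonmangoldt_ge0 //.
  by case/andP: (div_bounds d d_gt0).
have := psi_le N; set S := \sum_(_ <= d < _) _ / _ in ub2 lb2 *.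
move=> psiN; rewrite -(ler_pM2l N_gt0') -{1}(ger0_norm (ltW N_gt0')) -normrM ler_norml.
by rewrite mulrBr; apply/andP; split; move: sum_eq ub lb ub2 lb2 psiN; lra.
Qed.

(** This is psi(N) / N, kept in the shape in which errors d / N of inner sums of length N / d get
    weighted. *)
Lemma sum_vonmangoldt_div_psi N : 
  \sum_(1 <= d < N.+1) L d / d%:R * (d%:R / N%:R) <= 4.
Proof.
case: N => [|N]; first by rewrite big_geq // ler0n.
apply: (@le_trans _ _ (psi N.+1 / N.+1%:R)); last by rewrite ler_pdivrMr ?ltr0n // psi_le.
rewrite /psi mulr_suml big_seq [leRHS]big_seq; apply: ler_sum => d.
rewrite mem_index_iota => /andP[d_gt0 _].
by rewrite mulrA mulfVK // pnatr_eq0; lia.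
Qed.

Lemma vonmangoldt_composite n : ~~ prime n -> L n != 0 ->
  exists p e, [/\ prime p, (1 < e)%N, n = (p ^ e)%N & L n = ln p%:R].
Proof.
move=> n_pr; rewrite /vonmangoldt; case prn: (primes n) => [|p [|]]; rewrite ?eqxx // => _.
have : p \in primes n by rewrite prn mem_head.
rewrite mem_primes => /and3P[p_pr n_gt0 p_n].
have [m p_m def_n] := pfactor_coprime p_pr n_gt0.
have m_gt0 : (0 < m)%N by move: n_gt0; rewrite {1}def_n muln_gt0 => /andP[].
have m1 : m = 1%N.
  apply/eqP; rewrite eqn_leq m_gt0 andbT leqNgt; apply/negP => m_gt1.
  have : pdiv m \in primes n.
    by rewrite mem_primes pdiv_prime // n_gt0 def_n dvdn_mulr // pdiv_dvd.
  rewrite prn inE => /eqP pm; move: p_m; rewrite prime_coprime // -pm pdiv_dvd //.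
rewrite m1 mul1n in def_n; exists p, (logn p n); split => //.
case: (logn p n) def_n => [|[|//]] def_n; last by rewrite def_n p_pr in n_pr.
by move: prn; rewrite def_n.
Qed.

(** The right side is chosen so that the induction closes: its increment dominates the new term
    because (N + 2) (ln (N + 2) - ln (N + 1)) <= 2. *)
Lemma sum_inv_sqr_ln N :
  \sum_(2 <= n < N.+2) ln n%:R / (n * n.-1)%:R <= 2 - (ln N.+1%:R + 2) / N.+1%:R :> R.
Proof.
elim: N => [|N IH]; first by rewrite big_geq // ln1 add0r divr1 subrr.
rewrite big_nat_recr //=; apply: (le_trans (lerD IH (lexx _))).
have lnN := @lnS_ub R N.+1 isT.
set a := ln N.+1%:R in lnN *; set b := ln N.+2%:R in lnN *.
have N1 : 1 <= N.+1%:R :> R by rewrite ler1n.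
rewrite -lerBrDl natrM.
have -> : N.+2%:R = N.+1%:R + 1 :> R by rewrite natr1.
set x := N.+1%:R in lnN N1 *.
rewrite (_ : _ - _ = ((x + 1) * (a + 2) - x * (b + 2)) / ((x + 1) * x)); last first.
  by field; rewrite !lt0r_neq0 //; lra.
rewrite ler_pM2r; last by rewrite invr_gt0 mulr_gt0; lra.
have : (x + 1) * (b - a) <= 2.
  apply: (@le_trans _ _ ((x + 1) * x^-1)); first by rewrite ler_wpM2l //; lra.
  by rewrite ler_pdivrMr; lra.
lra.
Qed.

(** Only powers p^e with e >= 2 contribute, and the geometric series in e is at most 1 / (p (p -
    1)). *)
Lemma sum_composite_vonmangoldt N :
  \sum_(1 <= n < N.+1 | ~~ prime n) L n / n%:R <= 2.
Proof.
rewrite (bigID (fun n => L n == 0)) /= [X in X + _]big1 ?add0r; last first.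
  by move=> n /andP[_ /eqP->]; rewrite mul0r.
pose H (j : nat * nat) : R := if prime j.1 then ln j.1%:R / (j.1 ^ j.2)%:R else 0.
rewrite -big_filter.
apply: (@le_trans _ _ (\sum_(j <- [seq (p, e) | p <- index_iota 2 N.+2, e <- index_iota 2
  N.+2]) H j)).
  apply: (@ler_sum_onto _ _ _ _ _ _ _ (fun j => (j.1 ^ j.2)%N)).
  - by rewrite filter_uniq ?iota_uniq.
  - by move=> j _; rewrite /H; case: ifP => // _; rewrite divr_ge0 ?ln_nat_ge0.
  move=> n; rewrite mem_filter mem_index_iota => /andP[/andP[n_pr Ln] /andP[n_gt0 n_N]].
  have [p [e [p_pr e_gt1 def_n ->]]] := vonmangoldt_composite n_pr Ln.
  have p_gt1 := prime_gt1 p_pr.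
  exists (p, e); last by rewrite /H /= p_pr def_n.
  have p_n : (p <= n)%N by rewrite def_n -{1}(expn1 p) leq_exp2l //; lia.
  have e_n : (e < n)%N by rewrite def_n ltn_expl.
  by apply/allpairsP; exists (p, e); rewrite !mem_index_iota /=; split => //; lia.
rewrite big_allpairs_dep.
apply: le_trans (le_trans (sum_inv_sqr_ln N) _); last first.
  by rewrite gerBl divr_ge0 // addr_ge0 ?ln_nat_ge0.
rewrite big_seq [leRHS]big_seq; apply: ler_sum => p; rewrite mem_index_iota => /andP[p_gt1 _].
have [p_pr|p_npr] := boolP (prime p); last first.
  by rewrite big1 ?divr_ge0 ?ln_nat_ge0 // => e _; rewrite /H /= (negPf p_npr).
under eq_bigr do rewrite /H /= p_pr.
rewrite -mulr_sumr ler_wpM2l ?ln_nat_ge0 //.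
have p2 : 2 <= p%:R :> R by rewrite ler_nat.
have def_p1 : p.-1%:R = p%:R - 1 :> R by rewrite -subn1 natrB // ltnW.
rewrite natrM def_p1; set x := p%:R in p2 *.
suff : \sum_(2 <= e < N.+2) (p ^ e)%:R^-1 = (x * (x - 1))^-1 - (x ^+ N.+1 * (x - 1))^-1.
  by move=> ->; rewrite gerBl invr_ge0 mulr_ge0 ?exprn_ge0 //; lra.
elim: N => [|N IHN]; first by rewrite big_geq // expr1 subrr.
rewrite big_nat_recr //= IHN natrX -/x !exprS; field.
by rewrite expf_neq0 !lt0r_neq0 //; lra.
Qed.

End Mertens.

(** * Convolution operators on a finite abelian group *)

Section GroupConvolution.
Variables (R : realType) (gT : finGroupType).
Hypothesis mulC : commutative (@mulg gT).
Implicit Types (l f k : gT -> R).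

(** The argument of f is g h rather than g h^-1, to match the sum over k of f(d k) / k. *)
Definition conv l f (g : gT) : R := \sum_h l h * f (g * h)%g.

Lemma eq_conv l f f' : f =1 f' -> conv l f =1 conv l f'.
Proof. by move=> ff' g; apply: eq_bigr => h _; rewrite ff'. Qed.

Lemma conv_translate l f a g : conv l (fun x => f (a * x)%g) g = conv l f (a * g)%g.
Proof. by apply: eq_bigr => h _; rewrite mulgA. Qed.

Lemma sum_translate (F : gT -> R) a : \sum_g F (a * g)%g = \sum_g F g.
Proof. by rewrite [RHS](reindex_inj (mulgI a)). Qed.

Lemma conv_comm l l' f g : conv l (conv l' f) g = conv l' (conv l f) g.
Proof.
rewrite /conv; under eq_bigr do rewrite mulr_sumr.
rewrite exchange_big /=; apply: eq_bigr => h' _; rewrite mulr_sumr.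
by apply: eq_bigr => h _; rewrite mulrCA -!mulgA [(h * h')%g]mulC.
Qed.

Lemma conv_adjoint l f f' :
  \sum_g conv l f g * f' g = \sum_g f g * conv (fun h => l h^-1%g) f' g.
Proof.
under eq_bigr do rewrite mulr_suml; under [RHS]eq_bigr do rewrite mulr_sumr.
rewrite exchange_big /= [RHS]exchange_big /= [RHS](reindex_inj invg_inj) /=.
apply: eq_bigr => h _; rewrite [RHS](reindex_inj (mulIg h)) /=.
by apply: eq_bigr => g _; rewrite mulgK invgK; ring.
Qed.

Lemma sum_sqr_eq0 f : \sum_g f g * f g = 0 -> forall g, f g = 0.
Proof.
move=> f0 g; apply/eqP; rewrite -[_ == _]orbb -mulf_eq0; apply/eqP.
by apply: (psumr_eq0P (P := predT) _ f0) => // h _; rewrite -expr2 sqr_ge0.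
Qed.

(** Let T be the operator and T' its adjoint. The squared norm of T' f is the pairing of T (T' f) =
    T' (T f) with f, since T and T' commute. *)
Lemma conv_ker_adjoint l f :
  (forall g, conv l f g = 0) -> forall g, conv (fun h => l h^-1%g) f g = 0.
Proof.
move=> lf; apply: sum_sqr_eq0.
rewrite -conv_adjoint big1 // => g _; rewrite conv_comm.
by rewrite (eq_conv _ (f' := fun=> 0) lf) /conv big1 ?mul0r // => h _; rewrite mulr0.
Qed.

Lemma conv_ker_image l f :
  (forall g, conv l (conv l f) g = 0) -> forall g, conv l f g = 0.
Proof.
move=> llf; apply: sum_sqr_eq0; rewrite conv_adjoint big1 // => g _.
by rewrite conv_ker_adjoint // mulr0.
Qed.

(* The convolution operator is normal, so its kernel and its image are complementary. *)
Lemma delta_decomposition l : exists k w : gT -> R,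
  (forall g, (g == 1%g)%:R = k g + conv l w g) /\ (forall g, conv l k g = 0).
Proof.
pose V := {ffun gT -> R^o}.
pose T (f : V) : V := [ffun g => conv l f g].
have T_lin : linear T.
  move=> a u v; apply/ffunP => g; rewrite !ffunE /= /conv scaler_sumr -big_split /=.
  by apply: eq_bigr => h _; rewrite !ffunE /= mulrDr; congr (_ + _); exact: mulrCA.
pose TL := GRing.isLinear.Build _ _ _ _ T T_lin.
pose T' : {linear V -> V} := HB.pack T TL.
pose L := linfun T'.
have LE (u : V) : L u = T u by rewrite lfunE.
have disj : (lker L :&: limg L = 0)%VS.
  apply/eqP; rewrite -subv0; apply/subvP => v; rewrite memv_cap memv_ker => /andP[/eqP Lv].
  case/memv_imgP => u _ def_v; rewrite memv0; apply/eqP/ffunP => g.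
  rewrite def_v LE !ffunE; apply: conv_ker_image => h.
  have := congr1 (fun f : V => f h) Lv; rewrite def_v !LE !ffunE => <-.
  by apply: eq_conv => x; rewrite ffunE.
(* Rank-nullity: the trivial intersection gives the sum full dimension. *)
have full : (lker L + limg L = fullv)%VS.
  apply/eqP; rewrite eqEdim subvf dimv_disjoint_sum //.
  by rewrite -(limg_ker_dim L fullv) capfv leqnn.
have /memv_addP[k k_ker [v /memv_imgP[w _ ->] def_d]] :
  ([ffun g => (g == 1%g)%:R] : V) \in (lker L + limg L)%VS by rewrite full memvf.
exists k, w; split => g.
  by have := congr1 (fun f : V => f g) def_d; rewrite LE !ffunE.
by move: k_ker; rewrite memv_ker LE => /eqP/ffunP/(_ g); rewrite !ffunE.
Qed.

(** The translates of k lie in the kernel, which is orthogonal to the image; so pairing a translate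
    with k is the same as pairing it with delta_1, that is, evaluating it at 1. *)
Lemma delta_ker_reproducing l k w :
  (forall g, (g == 1%g)%:R = k g + conv l w g) -> (forall g, conv l k g = 0) ->
  forall g, \sum_h k (g * h)%g * k h = k g.
Proof.
move=> dec lk g.
have kE h : k h = (h == 1%g)%:R - conv l w h by rewrite dec addrK.
under eq_bigr do rewrite [k _ in X in _ * X]kE mulrBr.
rewrite sumrB (bigD1 1%g) //= eqxx mulr1 mulg1 big1 ?addr0 => [|h /negPf->];
  last by rewrite mulr0.
rewrite (eq_bigr (fun h => conv l w h * k (g * h)%g)) => [|h _]; last by rewrite mulrC.
rewrite conv_adjoint big1 ?subr0 // => h _.
by rewrite conv_ker_adjoint ?mulr0 // => x; rewrite conv_translate.
Qed.

(* By Cauchy-Schwarz |k g| <= k 1 = sum k^2 <= #|gT| (k 1)^2, so k 1 <= 1 / #|gT|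
   forces equality everywhere. *)
Lemma reproducing_sign k :
  (forall g, \sum_h k (g * h)%g * k h = k g) ->
  k 1%g <= #|gT|%:R^-1 -> k 1%g != 0 ->
  exists chi : gT -> R, [/\ forall g, chi g = 1 \/ chi g = -1,
    forall g h, chi (g * h)%g = chi g * chi h & forall g, k g = chi g / #|gT|%:R].
Proof.
move=> rep k1_le k1_neq0; set n : R := #|gT|%:R in k1_le *.
have n_gt0 : 0 < n by rewrite ltr0n; apply/card_gt0P; exists 1%g.
have sum_k2 : \sum_h k h ^+ 2 = k 1%g.
  by rewrite -rep; apply: eq_bigr => h _; rewrite mul1g expr2.
have k1_ge0 : 0 <= k 1%g by rewrite -sum_k2 sumr_ge0 // => h _; rewrite sqr_ge0.
have k1_gt0 : 0 < k 1%g by rewrite lt_neqAle eq_sym k1_neq0.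
have k_le g : k g ^+ 2 <= (k 1%g) ^+ 2.
  have sum_k2g : \sum_h k (g * h)%g ^+ 2 = k 1%g by rewrite (sum_translate (fun h => k h ^+ 2)).
  (* Cauchy-Schwarz by expanding a square; s = 1 and s = -1 control both signs of [k g]. *)
  have bnd (s : R) : s ^+ 2 = 1 -> s * k g <= k 1%g.
    move=> s2; have : 0 <= \sum_h (k (g * h)%g - s * k h) ^+ 2.
      by apply: sumr_ge0 => h _; rewrite sqr_ge0.
    under eq_bigr do rewrite sqrrB exprMn s2 mul1r.
    rewrite big_split /= sumrB sum_k2g sum_k2 sumrMnl.
    under eq_bigr do rewrite mulrCA.
    by rewrite -mulr_sumr rep; lra.
  have := bnd 1 (expr1n _ _); have := bnd (-1); rewrite sqrrN expr1n => /(_ erefl).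
  by rewrite mulN1r mul1r => h1 h2; nra.
have k1E : k 1%g = n^-1.
  apply/eqP; rewrite eq_le k1_le /= -[n^-1]mul1r ler_pdivrMr //.
  have : \sum_h k h ^+ 2 <= \sum_(h : gT) (k 1%g) ^+ 2 by apply: ler_sum => h _.
  rewrite sum_k2 sumr_const -mulr_natr -/n expr2 -mulrA.
  by rewrite -{1}[k 1%g]mulr1 ler_pM2l // mulrC.
have k2E g : k g ^+ 2 = n^-1 ^+ 2.
  apply/eqP; rewrite eq_sym -subr_eq0; apply/eqP.
  apply: (psumr_eq0P (P := predT) (F := fun g => n^-1 ^+ 2 - k g ^+ 2)) => //.
    by move=> h _; rewrite subr_ge0 -k1E.
  rewrite sumrB sum_k2 sumr_const k1E -mulr_natr -/n expr2 mulfVK ?subrr //.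
  exact: lt0r_neq0.
pose chi g := n * k g.
have chi2 g : chi g ^+ 2 = 1 by rewrite exprMn k2E -exprMn divff ?expr1n ?lt0r_neq0.
have chi_pm g : chi g = 1 \/ chi g = -1.
  by have /eqP := chi2 g; rewrite sqrf_eq1 => /orP[]/eqP; [left|right].
have kE g : k g = chi g / n by rewrite /chi mulrAC divff ?mul1r ?lt0r_neq0.
(* Every term is 1 minus a sign, hence nonnegative; the zero sum makes each term vanish, which is
   multiplicativity. *)
have sum_chi g : \sum_h (1 - chi g * (chi (g * h)%g * chi h)) = 0.
  rewrite sumrB sumr_const -mulr_sumr -/n.
  rewrite (eq_bigr (fun h => n ^+ 2 * (k (g * h)%g * k h))); last by move=> h _; rewrite /chi;
    ring.
  by rewrite -mulr_sumr rep expr2 -mulrA -/(chi g) mulrCA -expr2 chi2 mulr1 subrr.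
exists chi; split => // g h.
have : 1 - chi g * (chi (g * h)%g * chi h) = 0.
  apply: (psumr_eq0P (P := predT) _ (sum_chi g)) => // x _.
  by case: (chi_pm g) (chi_pm (g * x)%g) (chi_pm x) => -> [] -> [] ->; lra.
by case: (chi_pm g) (chi_pm (g * h)%g) (chi_pm h) => -> [] -> [] ->; lra.
Qed.

End GroupConvolution.

(** * Real characters *)

Section RealCharacter.
Variables (R : realType) (X : nat -> R) (B C : R).
Hypothesis XM : forall a b, X (a * b)%N = X a * X b.
Hypothesis X1 : X 1%N = 1.
Hypothesis X_sign : forall n, [\/ X n = 0, X n = 1 | X n = -1].
Hypothesis X_sum : forall c, `|\sum_(1 <= i < c) X i| <= B.
(** This forces L(1, X) = 0, the assumption to be refuted. *)
Hypothesis X_series : forall K, `|\sum_(1 <= k < K.+1) X k / k%:R| <= C / K.+1%:R.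

(** These are the coefficients of zeta(s) L(s, X), and of the Lambert series of X. *)
Let F n := \sum_(d <- divisors n) X d.

Lemma char_powersum_ge0 x e : [\/ x = 0, x = 1 | x = -1] ->
  0 <= \sum_(i < e) x ^+ i :> R.
Proof.
case=> ->.
- by apply: sumr_ge0 => i _; rewrite expr0n; case: (_ == _).
- by apply: sumr_ge0 => i _; rewrite expr1n.
suff -> : \sum_(i < e) (-1) ^+ i = (odd e)%:R :> R by case: (odd e).
elim: e => [|e IH]; first by rewrite big_ord0.
rewrite big_ord_recr /= IH -signr_odd; case: (odd e); rewrite /= ?expr1 ?expr0; ring.
Qed.

Lemma char_powersum_ge1 x e : [\/ x = 0, x = 1 | x = -1] ->
  1 <= \sum_(i < e.*2.+1) x ^+ i :> R.
Proof.
move=> hx; rewrite big_ord_recl /= expr0 lerDl.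
case: hx => ->.
- by apply: sumr_ge0 => i _; rewrite expr0n.
- by apply: sumr_ge0 => i _; rewrite expr1n.
rewrite (_ : \sum_(i < e.*2) _ = 0) //.
elim: e => [|e IH]; first by rewrite big_ord0.
rewrite doubleS !big_ord_recr /= IH /bump /= !exprS; ring.
Qed.

Lemma char_divisor_sum n : (0 < n)%N -> 0 <= F n /\ 1 <= F (n ^ 2)%N.
Proof.
move: n; apply: pfactor_ind => [|p e n p_pr e_gt0 n_gt0 p_n [Fn_ge0 Fn2_ge1]].
  by rewrite /F !big_seq1 X1.
have XX i : X (p ^ i)%N = X p ^+ i.
  by elim: i => [|i IH]; rewrite ?X1 // expnS XM IH exprS.
have FM k m : (0 < m)%N -> ~~ (p %| m)%N ->
    F (p ^ k * m)%N = (\sum_(i < k.+1) X p ^+ i) * F m.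
  move=> m_gt0 p_m; rewrite /F sum_divisors_pfactor // mulr_suml; apply: eq_bigr => i _.
  by rewrite mulr_sumr; apply: eq_bigr => d _; rewrite XM XX.
split; first by rewrite FM // mulr_ge0 // char_powersum_ge0.
rewrite expnMn -expnM muln2 FM ?expn_gt0 ?n_gt0 //; last by rewrite Euclid_dvdX // (negPf p_n).
by rewrite -[leLHS]mulr1; apply: ler_pM => //; exact: char_powersum_ge1.
Qed.

(** With t = u^2 this is the inequality between the arithmetic and the geometric mean of 1, t, ...,
    t^(d-1), multiplied by 1 - t. The variable u avoids half-integral exponents of t. *)
Lemma one_sub_expr_ge (u : R) d : 0 <= u <= 1 ->
  d%:R * u ^+ d.-1 * (1 - u ^+ 2) <= 1 - (u ^+ 2) ^+ d.
Proof.
move=> /andP[u_ge0 u_le1].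
have u2_le1 : 0 <= 1 - u ^+ 2 by rewrite subr_ge0 expr_le1.
elim/ltn_ind: d => -[_|[_|d IH]];
  [by rewrite !mul0r expr0 subrr| by rewrite expr0 expr1 !mul1r |].
have {IH} := IH d (ltnW (ltnSn _)).
set y := (u ^+ 2) ^+ d => IH.
have -> : 1 - (u ^+ 2) ^+ d.+2 = u ^+ 2 * (1 - y) + (1 - u ^+ 2) * (1 + u ^+ 2 * y).
  by rewrite (exprS _ d.+1) (exprS _ d) -/y; ring.
have h1 : u ^+ 2 * (d%:R * u ^+ d.-1 * (1 - u ^+ 2)) = d%:R * u ^+ d.+1 * (1 - u ^+ 2).
  by case: (d) => [|k]; [rewrite !mul0r mulr0 | rewrite /= !exprS; ring].
have h2 : 2 * u ^+ d.+1 <= 1 + u ^+ 2 * y.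
  have -> : u ^+ 2 * y = (u ^+ d.+1) ^+ 2 by rewrite /y -exprS -!exprM mulnC.
  have := sqr_ge0 (1 - u ^+ d.+1); rewrite sqrrB expr1n mul1r; lra.
have h3 := ler_wpM2l u2_le1 h2; have h4 := ler_wpM2l (sqr_ge0 u) IH.
rewrite [d.+2.-1]/= -addn2 natrD; move: h3 h4; rewrite h1; lra.
Qed.

(** Monotonicity amounts to d (d + 1) t^d (1 - t)^2 <= (1 - t^d) (1 - t^(d+1)), which follows by
    multiplying [one_sub_expr_ge] for d and d + 1. *)
Lemma lambert_weight_dec (u : R) d : 0 < u < 1 -> (0 < d)%N ->
  let t := u ^+ 2 in let b d := (d%:R * (1 - t))^-1 - t ^+ d / (1 - t ^+ d) in
  b d.+1 <= b d /\ 0 <= b d.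
Proof.
move=> /andP[u_gt0 u_lt1] d_gt0 t b.
have u01 : 0 <= u <= 1 by rewrite !ltW.
have t_gt0 : 0 < t by rewrite exprn_gt0.
have t_lt1 : t < 1 by rewrite expr_lt1 // ltW.
have s_gt0 : 0 < 1 - t by rewrite subr_gt0.
have tk_lt1 k : (0 < k)%N -> 0 < 1 - t ^+ k.
  by move=> k_gt0; rewrite subr_gt0 expr_lt1 // -?lt0n // ltW.
have d_gt0' : 0 < d%:R :> R by rewrite ltr0n.
have h1 := one_sub_expr_ge d u01; have h2 := one_sub_expr_ge d.+1 u01.
rewrite -/t in h1 h2.
have tdE : t ^+ d = u * u ^+ d.-1 * u ^+ d.
  by rewrite -exprS prednK // /t -exprM mul2n -addnn exprD.
have ud0 : 0 <= u ^+ d.-1 by rewrite exprn_ge0 // ltW.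
have ud1 : 0 <= u ^+ d by rewrite exprn_ge0 // ltW.
have ud1_le : u ^+ d <= 1 by rewrite expr_le1 // ltW.
have ud_le : u * u ^+ d.-1 * u ^+ d <= u ^+ d.-1 * u ^+ d.
  by rewrite -mulrA ler_piMl ?mulr_ge0 // ltW.
split.
  rewrite -subr_ge0.
  have -> : b d - b d.+1 = ((1 - t ^+ d) * (1 - t ^+ d.+1) - d%:R * (d%:R + 1) * t ^+ d * (1 -
    t) ^+ 2) /
     (d%:R * (d%:R + 1) * (1 - t) * (1 - t ^+ d) * (1 - t ^+ d.+1)).
    have n1 := lt0r_neq0 (tk_lt1 d d_gt0); have n2 := lt0r_neq0 (tk_lt1 d.+1 isT).
    have n3 := lt0r_neq0 s_gt0; have n4 := lt0r_neq0 d_gt0'.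
    have n5 : d%:R + 1 != 0 :> R by rewrite natr1 pnatr_eq0.
    rewrite /b -natr1; move: n1 n2; rewrite exprS; set y := t ^+ d => n1 n2.
    by field; rewrite n1 n2 n3 n4 n5.
  rewrite divr_ge0 ?mulr_ge0 ?(ltW d_gt0') ?(ltW s_gt0) ?(ltW (tk_lt1 _ _)) ?natr1 //.
  have p1 : 0 <= d%:R * u ^+ d.-1 * (1 - t) by rewrite !mulr_ge0 // ltW.
  have p2 : 0 <= d.+1%:R * u ^+ d.+1.-1 * (1 - t) by rewrite !mulr_ge0 // ltW.
  rewrite subr_ge0; apply: le_trans (ler_pM p1 p2 h1 h2).
  rewrite tdE -natr1 [d.+1.-1]/=.
  have -> : d%:R * u ^+ d.-1 * (1 - t) * ((d%:R + 1) * u ^+ d * (1 - t)) =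
    d%:R * (d%:R + 1) * (u ^+ d.-1 * u ^+ d) * (1 - t) ^+ 2 by ring.
  by rewrite ler_wpM2r ?sqr_ge0 // ler_wpM2l // mulr_ge0 ?natr1.
rewrite /b subr_ge0 ler_pdivrMr ?tk_lt1 // mulrC ler_pdivlMr ?mulr_gt0 //.
apply: le_trans h1; rewrite mulrA ler_wpM2r ?(ltW s_gt0) // mulrC ler_wpM2l //.
by rewrite tdE; apply: (le_trans ud_le); rewrite ler_piMr.
Qed.

(** The three terms bound the partial sum of L(1, X), the sum of X d against the decreasing weights
    of [lambert_weight_dec] (the first of which is 1), and the truncation of the inner geometric
    series. *)
Lemma lambert_bound (u : R) N : 0 < u < 1 ->
  \sum_(1 <= n < N.+1) F n * (u ^+ 2) ^+ n <=
  C / N.+1%:R / (1 - u ^+ 2) + B + N%:R * (u ^+ 2) ^+ N / (1 - u ^+ 2).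
Proof.
move=> u01; have /andP[u_gt0 u_lt1] := u01; set t := u ^+ 2.
have t_gt0 : 0 < t by rewrite exprn_gt0.
have t_lt1 : t < 1 by rewrite expr_lt1 // ltW.
have s_gt0 : 0 < 1 - t by rewrite subr_gt0.
have td_lt1 d : (0 < d)%N -> t ^+ d <= t.
  by move=> d_gt0; rewrite -[leRHS]expr1 ler_wiXn2l // ltW.
have B_ge0 : 0 <= B by apply: le_trans (X_sum 0); rewrite normr_ge0.
pose b d := (d%:R * (1 - t))^-1 - t ^+ d / (1 - t ^+ d).
have -> : \sum_(1 <= n < N.+1) F n * t ^+ n =
    \sum_(1 <= d < N.+1) \sum_(1 <= k < (N %/ d).+1) X d * t ^+ (d * k).
  rewrite -(sum_hyperbola N (fun d k => X d * t ^+ (d * k)));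
    apply: eq_big_nat => n /andP[n_gt0 _].
  rewrite /F mulr_suml big_seq [RHS]big_seq; apply: eq_bigr => d;
    rewrite -dvdn_divisors // => d_n.
  by rewrite mulnC divnK.
have geo d K : (0 < d)%N ->
    \sum_(1 <= k < K.+1) t ^+ (d * k) = t ^+ d / (1 - t ^+ d) - t ^+ (d * K.+1) / (1 - t ^+ d).
  move=> d_gt0; have nz : 1 - t ^+ d != 0 by rewrite lt0r_neq0 // subr_gt0 (le_lt_trans
    (td_lt1 d d_gt0)).
  elim: K => [|K IH]; first by rewrite big_geq // muln1 subrr.
  rewrite big_nat_recr //= IH !mulnS !exprD; field; exact: nz.
rewrite (eq_big_nat _ _ (F2 := fun d => X d / d%:R * (1 - t)^-1 - X d * b d
   - X d * (t ^+ (d * (N %/ d).+1) / (1 - t ^+ d)))); last first.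
  move=> d /andP[d_gt0 _]; rewrite -mulr_sumr geo // /b invfM; ring.
rewrite !sumrB -mulr_suml; apply: lerD; first apply: lerD.
- rewrite ler_pM2r ?invr_gt0 //; exact: le_trans (ler_norm _) (X_series N).
- apply: le_trans (ler_norm _) _; rewrite normrN.
  have -> : B = B * b 1%N.
    rewrite /b mul1r expr1; have := lt0r_neq0 s_gt0 => nz; field; exact: nz.
  by apply: abel_summation => // i i_gt0; case: (lambert_weight_dec u01 i_gt0).
apply: le_trans (ler_norm _) _; rewrite normrN; apply: le_trans (ler_norm_sum _ _ _) _.
rewrite (_ : _ / _ = \sum_(1 <= d < N.+1) t ^+ N / (1 - t)); last first.
  by rewrite sumr_const_nat subn1 -mulrA mulr_natl.
rewrite big_seq [leRHS]big_seq; apply: ler_sum => d; rewrite mem_index_iota => /andP[d_gt0 _].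
have sd_gt0 : 0 < 1 - t ^+ d by rewrite subr_gt0 (le_lt_trans (td_lt1 d d_gt0)).
rewrite normrM -[leRHS]mul1r; apply: ler_pM => //.
  by case: (X_sign d) => ->; rewrite ?normr0 ?normrN1 ?normr1.
rewrite ger0_norm; last by rewrite divr_ge0 ?exprn_ge0 // ltW.
apply: ler_pM.
- by rewrite exprn_ge0 // ltW.
- by rewrite invr_ge0 ltW.
- by rewrite ler_wiXn2l ?(ltW t_gt0) ?(ltW t_lt1) // mulnC ltnW // ltn_ceil.
by rewrite lef_pV2 ?posrE // lerD2l lerN2 td_lt1.
Qed.

(* Monsky's argument: the Lambert series of X stays bounded as t tends to 1,
   while its coefficients are nonnegative and at least 1 at the squares. *)
Lemma real_character_series_neq0 : False.
Proof.
have B_ge0 : 0 <= B by apply: le_trans (X_sum 0); rewrite normr_ge0.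
have C_ge0 : 0 <= C.
  by have := X_series 0; rewrite divr1; apply: le_trans; rewrite normr_ge0.
have [K [K_gt0 BK]] : exists K : nat, (0 < K)%N /\ 2 * B + 4 < K%:R.
  by exists (Num.trunc (2 * B + 4)).+1; split => //; exact: truncnS_gt.
(* With t = (1 - dl)^4, Bernoulli's inequality gives t^(k^2) >= 1 - m dl = 1/2 for all k <= K, so
   the squares contribute at least K / 2 > B + 2. *)
pose m := (4 * K ^ 2)%N; pose dl : R := (2 * m%:R)^-1.
have m_ge4 : 4 <= m%:R :> R by rewrite ler_nat /m; nia.
have dl_gt0 : 0 < dl by rewrite invr_gt0; lra.
have dl_m : m%:R * dl = 2^-1.
  rewrite /dl; field; rewrite lt0r_neq0 //; lra.
have dl_lt1 : dl < 1 by nra.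
have bernoulli n : 1 - n%:R * dl <= (1 - dl) ^+ n.
  elim: n => [|n IH]; first by rewrite mul0r subr0.
  rewrite exprS; have h : 0 <= 1 - dl by lra.
  have := ler_wpM2l h IH; have := ler0n R n; rewrite -natr1; nra.
have bernoulli2 n : (1 - dl) ^+ n * (1 + n%:R * dl) <= 1.
  elim: n => [|n IH]; first by rewrite mul0r addr0 mulr1.
  apply: le_trans IH; rewrite exprS [_ * (1 - dl) ^+ n]mulrC -mulrA ler_wpM2l //.
    by rewrite exprn_ge0 //; lra.
  by have := ler0n R n; rewrite -natr1; nra.
pose v := 1 - dl; have v_gt0 : 0 < v by rewrite /v; lra.
have v_lt1 : v < 1 by rewrite /v; lra.
have u01 : 0 < v ^+ 2 < 1 by rewrite exprn_gt0 // expr_lt1 // ltW.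
have t_gt0 : 0 < (v ^+ 2) ^+ 2 by rewrite !exprn_gt0.
have t_lt1 : (v ^+ 2) ^+ 2 < 1 by rewrite !expr_lt1 ?exprn_ge0 ?ltW // ltW.
pose t := (v ^+ 2) ^+ 2; rewrite -/t in t_gt0 t_lt1.
have s_gt0 : 0 < 1 - t by rewrite subr_gt0.
(* N reaches all the squares up to K^2 and makes the first and the last term of [lambert_bound] at
   most 1. *)
have [N [K_N [N1 N2]]] : exists N, (K ^ 2 <= N)%N /\
    C / (1 - t) <= N%:R /\ (dl ^+ 2 * (1 - t))^-1 <= N%:R.
  have h1 : 0 <= C / (1 - t) by rewrite divr_ge0 // ltW.
  have h2 : 0 <= (dl ^+ 2 * (1 - t))^-1 by rewrite invr_ge0 mulr_ge0 ?sqr_ge0 // ltW.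
  exists (K ^ 2 + (Num.trunc (C / (1 - t))).+1 + (Num.trunc (dl ^+ 2 * (1 - t))^-1).+1)%N.
  split; first by rewrite -addnA leq_addr.
  have := truncnS_gt (C / (1 - t)); have := truncnS_gt ((dl ^+ 2 * (1 - t))^-1).
  rewrite !natrD; set a := _.+1%:R; set b := _.+1%:R; have := ler0n R (K ^ 2); lra.
have N_gt0 : 0 < N%:R :> R by rewrite ltr0n (leq_trans _ K_N) // expn_gt0 K_gt0.
have up := lambert_bound N u01; rewrite -/t in up.
have e1 : C / N.+1%:R / (1 - t) <= 1.
  rewrite mulrAC ler_pdivrMr ?ltr0n // mul1r -natr1; lra.
have e2 : N%:R * t ^+ N / (1 - t) <= 1.
  rewrite ler_pdivrMr // mul1r.
  have tN : t ^+ N * (N%:R * dl) ^+ 2 <= 1.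
    have vN : v ^+ N * (N%:R * dl) <= 1.
      apply: le_trans (bernoulli2 N); rewrite ler_wpM2l ?exprn_ge0 ?(ltW v_gt0) //; lra.
    have -> : t ^+ N = (v ^+ N) ^+ 2 * (v ^+ N) ^+ 2 by rewrite /t !(exprAC _ _ N) -exprD -exprM.
    have vN1 : (v ^+ N) ^+ 2 <= 1 by rewrite -exprM exprn_ile1 // ltW.
    have vN0 : 0 <= v ^+ N by rewrite exprn_ge0 // ltW.
    rewrite -mulrA -exprMn -[leRHS]mulr1; apply: ler_pM; rewrite ?sqr_ge0 //.
    by rewrite expr_le1 // mulr_ge0 // mulr_ge0 ?(ltW dl_gt0) ?(ltW N_gt0).
  move: N2; rewrite -[(_ * _)^-1]mul1r ler_pdivrMr ?mulr_gt0 ?exprn_gt0 // => N2.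
  have tN0 : 0 <= t ^+ N by rewrite exprn_ge0 // ltW.
  rewrite -(ler_pM2l (_ : 0 < N%:R * dl ^+ 2)); last by rewrite mulr_gt0 ?exprn_gt0.
  rewrite [(_ * dl) ^+ 2]exprMn in tN; apply: le_trans (_ : 1 <= _); last by rewrite -mulrA.
  suff -> : N%:R * dl ^+ 2 * (N%:R * t ^+ N) = t ^+ N * (N%:R ^+ 2 * dl ^+ 2) by [].
  by ring.
have low : K%:R / 2 <= \sum_(1 <= n < N.+1) F n * t ^+ n.
  apply: (@le_trans _ _ (\sum_(1 <= k < K.+1) (2^-1 : R))).
    by rewrite sumr_const_nat subn1 -[leRHS]mulr_natl.
  rewrite big_seq.
  apply: (@le_trans _ _ (\sum_(k <- index_iota 1 K.+1) F (k ^ 2)%N * t ^+ (k ^ 2))).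
    rewrite [leRHS]big_seq; apply: ler_sum => k; rewrite mem_index_iota => /andP[k_gt0 k_K].
    have tk : 2^-1 <= t ^+ (k ^ 2).
      apply: (@le_trans _ _ (v ^+ m)).
        by apply: le_trans (bernoulli m); rewrite dl_m; lra.
      have -> : t ^+ (k ^ 2) = v ^+ (4 * k ^ 2) by rewrite /t -(exprM v) -exprM.
      by rewrite ler_wiXn2l ?(ltW v_gt0) ?(ltW v_lt1) // leq_mul // leq_sqr.
    have [_ Fk] := char_divisor_sum k_gt0.
    by rewrite -[leLHS]mul1r; apply: ler_pM => //; rewrite invr_ge0.
  rewrite -(big_map (fun k => k ^ 2)%N xpredT (fun n => F n * t ^+ n)).
  apply: (@ler_sum_onto _ _ _ _ _ _ _ id).
  - by rewrite map_inj_uniq ?iota_uniq // => x y /eqP; rewrite eqn_exp2r // => /eqP.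
  - move=> n; rewrite mem_index_iota => /andP[n_gt0 _].
    have [Fn _] := char_divisor_sum n_gt0.
    by rewrite mulr_ge0 // exprn_ge0 // ltW.
  move=> _ /mapP[k k_K ->]; exists (k ^ 2)%N => //; move: k_K; rewrite !mem_index_iota.
  move=> /andP[k_gt0 k_K]; rewrite expn_gt0 k_gt0 /= ltnS (leq_trans _ K_N) // leq_sqr //.
have := le_trans low (le_trans up (lerD (lerD e1 (lexx B)) e2)); move: BK; lra.
Qed.

End RealCharacter.

(** * Dirichlet's theorem *)

Section Dirichlet.
(** [cls] stands for reduction modulo m to the group of units, with [None] on the integers not prime
    to m. *)
Variables (R : realType) (gT : finGroupType) (cls : nat -> option gT) (B C0 : R).
Hypothesis mulC : commutative (@mulg gT).
Hypothesis clsM : forall a b,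
  cls (a * b)%N = obind (fun x => omap (fun y => (x * y)%g) (cls b)) (cls a).
Hypothesis cls1 : cls 1%N = Some 1%g.
Hypothesis cls_equidistributed : forall g a b,
  `|\sum_(a <= i < b) ((cls i == Some g)%:R - (cls i == Some 1%g)%:R)| <= B.
Hypothesis cls_none : forall N,
  \sum_(1 <= n < N.+1 | cls n == None) vonmangoldt R n / n%:R <= C0.
Implicit Types (f w : gT -> R) (g h : gT).
Local Notation L := (@vonmangoldt R).
Local Notation mu := (@moebius R).

Let D g i : R := (cls i == Some g)%:R - (cls i == Some 1%g)%:R.

Let B_ge0 : 0 <= B.
Proof. by apply: le_trans (cls_equidistributed 1%g 0 0); rewrite normr_ge0. Qed.

Definition class_fun f n : R := if cls n is Some g then f g else 0.

Lemma class_fun_sum f n : class_fun f n = \sum_g f g * (cls n == Some g)%:R.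
Proof.
rewrite /class_fun; case: (cls n) => [g|]; last by rewrite big1 // => g _; rewrite mulr0.
rewrite (bigD1 g) //= eqxx mulr1 big1 ?addr0 // => h hg.
by rewrite (_ : (Some g == Some h) = false) ?mulr0 //; apply/negP => /eqP[] gh;
  rewrite gh eqxx in hg.
Qed.

Lemma class_fun_sum0 f n : \sum_g f g = 0 -> class_fun f n = \sum_g f g * D g n.
Proof.
move=> f0; rewrite class_fun_sum; under [RHS]eq_bigr do rewrite mulrBr.
by rewrite sumrB -mulr_suml f0 mul0r subr0.
Qed.

Lemma class_fun_mul f d k g : cls d = Some g -> class_fun f (d * k)
  = class_fun (fun x => f (g * x)%g) k.
Proof. by rewrite /class_fun clsM => -> /=; case: (cls k). Qed.

Lemma class_fun_mul_none f d k : cls d = None -> class_fun f (d * k) = 0.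
Proof. by rewrite /class_fun clsM => ->. Qed.

Let nrm f := \sum_g `|f g|.

Lemma class_fun_interval_sum f a b : \sum_g f g = 0 ->
  `|\sum_(a <= i < b) class_fun f i| <= nrm f * B.
Proof.
move=> f0; under eq_bigr do rewrite class_fun_sum0 //.
rewrite exchange_big /= (le_trans (ler_norm_sum _ _ _)) // mulr_suml.
by apply: ler_sum => g _; rewrite -mulr_sumr normrM ler_wpM2l // cls_equidistributed.
Qed.

Lemma nrm_translate f g : nrm (fun x => f (g * x)%g) = nrm f.
Proof. by rewrite /nrm (sum_translate (fun x => `|f x|)). Qed.

(** Differences of two class indicators have bounded partial sums, so by Abel summation their sums
    against 1/k converge with error B / (K + 1); l collects the limits. *)
Lemma class_fun_series : exists l : gT -> R, \sum_g l g = 1 /\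
  forall f, \sum_g f g = 0 -> forall d K,
  `|\sum_(1 <= k < K.+1) class_fun f (d * k) / k%:R - class_fun (conv l f) d|
    <= nrm f * B / K.+1%:R.
Proof.
pose u g K : R := \sum_(1 <= k < K.+1) D g k / k%:R.
have inv_dec i : (1 <= i)%N -> i.+1%:R^-1 <= i%:R^-1 :> R.
  by move=> i_gt0; rewrite lef_pV2 ?posrE ?ltr0n // ler_nat.
have u_step g K M : (K <= M)%N -> `|u g M - u g K| <= B / K.+1%:R.
  move=> K_M; rewrite /u (big_cat_nat _ (n := K.+1)) //= addrAC subrr add0r.
  apply: (@abel_summation _ _ (fun k => k%:R^-1)) => // [c|i iK|i _].
  - exact: cls_equidistributed.
  - by rewrite inv_dec //; lia.
  by rewrite invr_ge0.
have [l0 l0P] : exists l0 : gT -> R, forall g K, `|u g K - l0 g| <= B / K.+1%:R.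
  have h g : exists l, forall K, `|u g K - l| <= B / K.+1%:R.
    apply: cauchy_limit => K M; case: (leqP K M) => [K_M|/ltnW M_K].
      by rewrite distrC (le_trans (u_step g _ _ K_M)) // lerDl divr_ge0.
    by rewrite (le_trans (u_step g _ _ M_K)) // lerDr divr_ge0.
  exact: (fin_all_exists h).
(* Adding a constant to the weights does not change [conv] on functions of sum 0; this constant
   makes the total weight 1, so that [conv l] preserves sums and fixes constants. *)
pose c : R := (1 - \sum_g l0 g) / #|gT|%:R.
have n_neq0 : #|gT|%:R != 0 :> R.
  by rewrite pnatr_eq0 -lt0n; apply/card_gt0P; exists 1%g.
exists (fun g => l0 g + c); split.
  by rewrite big_split /= sumr_const -mulr_natr divfK // addrC subrK.
move=> f f0 d K; rewrite /(class_fun (conv _ _)); case cd: (cls d) => [g|]; last first.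
  rewrite big1 ?subr0 ?normr0; first by rewrite !mulr_ge0 ?invr_ge0 // sumr_ge0.
  by move=> k _; rewrite class_fun_mul_none // mul0r.
have f0g : \sum_h f (g * h)%g = 0 by rewrite sum_translate.
have -> : conv (fun g => l0 g + c) f g = \sum_h f (g * h)%g * l0 h.
  rewrite /conv; under eq_bigr do rewrite mulrDl.
  by rewrite big_split /= -mulr_sumr f0g mulr0 addr0; apply: eq_bigr => h _; rewrite mulrC.
have -> : \sum_(1 <= k < K.+1) class_fun f (d * k) / k%:R = \sum_h f (g * h)%g * u h K.
  under eq_bigr do rewrite (class_fun_mul _ _ cd) class_fun_sum0 // mulr_suml.
  rewrite exchange_big /=; apply: eq_bigr => h _; rewrite mulr_sumr.
  by apply: eq_bigr => k _; rewrite mulrA.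
rewrite -sumrB (le_trans (ler_norm_sum _ _ _)) // -(nrm_translate f g) !mulr_suml.
by apply: ler_sum => h _; rewrite -mulrBr normrM -mulrA ler_wpM2l.
Qed.

Definition mangoldt_sum f N : R := \sum_(1 <= n < N.+1) L n / n%:R * class_fun f n.

Lemma eq_mangoldt_sum f f' N : f =1 f' -> mangoldt_sum f N = mangoldt_sum f' N.
Proof.
by move=> ff'; apply: eq_bigr => n _; rewrite /class_fun; case: (cls n) => // g; rewrite ff'.
Qed.

Lemma mangoldt_sum_lin f f' a N :
  mangoldt_sum (fun g => f g + a * f' g) N = mangoldt_sum f N + a * mangoldt_sum f' N.
Proof.
rewrite /mangoldt_sum mulr_sumr -big_split /=; apply: eq_bigr => n _.
by rewrite /class_fun; case: (cls n) => [g|]; ring.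
Qed.

Lemma mangoldt_sum_ge0 f N : (forall g, 0 <= f g) -> 0 <= mangoldt_sum f N.
Proof.
move=> f_ge0; apply: sumr_ge0 => n _; rewrite mulr_ge0 ?divr_ge0 ?vonmangoldt_ge0 //.
by rewrite /class_fun; case: (cls n).
Qed.

Lemma inv_divS N d : (0 < d)%N -> (0 < N)%N -> ((N %/ d).+1%:R^-1 : R) <= d%:R / N%:R.
Proof.
move=> d_gt0 N_gt0; rewrite ler_pdivlMr ?ltr0n // mulrC ler_pdivrMr ?ltr0n //.
by rewrite -natrM ler_nat mulnC ltnW // ltn_ceil.
Qed.

Variable l : gT -> R.
Hypothesis sum_l : \sum_g l g = 1.
Hypothesis lP : forall f, \sum_g f g = 0 -> forall d K,
  `|\sum_(1 <= k < K.+1) class_fun f (d * k) / k%:R - class_fun (conv l f) d|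
    <= nrm f * B / K.+1%:R.

Lemma sum_conv f : \sum_g conv l f g = \sum_g f g.
Proof.
rewrite /conv exchange_big /= -[RHS]mul1r -sum_l mulr_suml; apply: eq_bigr => h _.
by rewrite -mulr_sumr; congr (_ * _); rewrite [RHS](reindex_inj (mulIg h)).
Qed.

(* Expand ln n = sum_(d | n) Lambda(d) in the bounded sum of f(n) ln n / n. *)
Lemma mangoldt_sum_conv f : \sum_g f g
  = 0 -> exists C, forall N, `|mangoldt_sum (conv l f) N| <= C.
Proof.
move=> f0; set A := nrm f * B.
have A_ge0 : 0 <= A by rewrite mulr_ge0 // sumr_ge0.
exists (A * 2 + A * 4) => N; case: (posnP N) => [->|N_gt0].
  by rewrite /mangoldt_sum big_geq // normr0; lra.
have lhs : `|\sum_(1 <= n < N.+1) class_fun f n * (ln n%:R / n%:R)| <= A * 2.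
  (* ln n / n increases at first, whereas (ln n + 1) / n and 1 / n decrease from n = 1 on, as Abel
     summation requires. *)
  have -> : \sum_(1 <= n < N.+1) class_fun f n * (ln n%:R / n%:R) =
      \sum_(1 <= n < N.+1) class_fun f n * ((ln n%:R + 1) / n%:R) - \sum_(1
        <= n < N.+1) class_fun f n * n%:R^-1.
    by rewrite -sumrB; apply: eq_bigr => n _; ring.
  apply: le_trans (ler_normB _ _) _.
  have h1 : `|\sum_(1 <= n < N.+1) class_fun f n * ((ln n%:R + 1) / n%:R)|
    <= A * ((ln 1%:R + 1) / 1%:R).
    apply: (@abel_summation _ _ (fun n => (ln n%:R + 1) / n%:R)) => // [c|i i_gt0|i _].
    - exact: class_fun_interval_sum.
    - have := @lnS_ub R i i_gt0; have := @ln_nat_ge0 R i.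
      have i_gt0' : 0 < i%:R :> R by rewrite ltr0n.
      set a := ln i%:R; set b := ln i.+1%:R => a_ge0 ab.
      rewrite ler_pdivrMr ?ltr0n // mulrAC ler_pdivlMr // -natr1.
      have : (b - a) * i%:R <= 1 by rewrite -ler_pdivlMr // mul1r.
      nra.
    by rewrite divr_ge0 // addr_ge0 ?ln_nat_ge0.
  have h2 : `|\sum_(1 <= n < N.+1) class_fun f n * n%:R^-1| <= A * 1%:R^-1.
    apply: (@abel_summation _ _ (fun n => n%:R^-1)) => // [c|i i_gt0|i _].
    - exact: class_fun_interval_sum.
    - by rewrite lef_pV2 ?posrE ?ltr0n // ler_nat.
    by rewrite invr_ge0.
  by move: h1 h2; rewrite ln1 add0r !invr1 !mulr1; lra.
have eqS : \sum_(1 <= n < N.+1) class_fun f n * (ln n%:R / n%:R) =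
    \sum_(1 <= d < N.+1) L d / d%:R * \sum_(1 <= k < (N %/ d).+1) class_fun f (d * k) / k%:R.
  transitivity (\sum_(1 <= d < N.+1) \sum_(1
    <= k < (N %/ d).+1) L d / d%:R * (class_fun f (d * k) / k%:R)).
    rewrite -(sum_hyperbola N (fun d k => L d / d%:R * (class_fun f (d * k) / k%:R))).
    apply: eq_big_nat => n /andP[n_gt0 _]; rewrite -sum_vonmangoldt // mulrA mulr_sumr mulr_suml.
    rewrite big_seq [RHS]big_seq; apply: eq_bigr => d; rewrite -dvdn_divisors // => d_n.
    have d_gt0 := dvdn_gt0 n_gt0 d_n.
    rewrite [(d * _)%N]mulnC divnK // -{2}(divnK d_n) natrM invfM; ring.
  by apply: eq_bigr => d _; rewrite mulr_sumr.
have -> : mangoldt_sum (conv l f) N = \sum_(1 <= n < N.+1) class_fun f n * (ln n%:R / n%:R) -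
    \sum_(1 <= d < N.+1) L d / d%:R * (\sum_(1 <= k < (N %/ d).+1) class_fun f (d * k) / k%:R
       - class_fun (conv l f) d).
  by rewrite eqS -sumrB; apply: eq_bigr => d _; rewrite mulrBr opprB addrC subrK.
apply: le_trans (ler_normB _ _) _; apply: lerD => //.
apply: le_trans (ler_norm_sum _ _ _) _.
apply: le_trans (ler_wpM2l A_ge0 (sum_vonmangoldt_div_psi R N)).
rewrite mulr_sumr big_seq [leRHS]big_seq; apply: ler_sum => d.
rewrite mem_index_iota => /andP[d_gt0 _]; rewrite normrM [leRHS]mulrCA.
have Ld : 0 <= L d / d%:R by rewrite divr_ge0 ?vonmangoldt_ge0.
rewrite (ger0_norm Ld) ler_wpM2l // (le_trans (lP f0 _ _)) //.
by rewrite ler_wpM2l // inv_divS.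
Qed.

(* Here one expands Lambda(n) + [n = 1] ln N = sum_(d | n) mu(d) (ln N - ln d). *)
Lemma mangoldt_sum_ker f : (forall g, conv l f g = 0) ->
  exists C, forall N, (0 < N)%N -> `|mangoldt_sum f N + f 1%g * ln N%:R| <= C.
Proof.
move=> lf; have f0 : \sum_g f g = 0 by rewrite -sum_conv big1.
set A := nrm f * B; have A_ge0 : 0 <= A by rewrite mulr_ge0 // sumr_ge0.
exists A => N N_gt0.
have -> : mangoldt_sum f N + f 1%g * ln N%:R = \sum_(1 <= d < N.+1)
    mu d / d%:R * (ln N%:R - ln d%:R) * \sum_(1 <= k < (N %/ d).+1) class_fun f (d * k) / k%:R.
  transitivity (\sum_(1 <= d < N.+1) \sum_(1 <= k < (N %/ d).+1)
      mu d / d%:R * (ln N%:R - ln d%:R) * (class_fun f (d * k) / k%:R)); last first.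
    by apply: eq_bigr => d _; rewrite mulr_sumr.
  rewrite -(sum_hyperbola N (fun d k => mu d / d%:R * (ln N%:R - ln d%:R) * (class_fun f (d *
    k) / k%:R))).
  have -> : f 1%g * ln N%:R = \sum_(1 <= n < N.+1) (n == 1%N)%:R * ln N%:R / n%:R * class_fun f n.
    rewrite big_ltn // big1_seq; last first.
      move=> n /andP[_]; rewrite mem_index_iota => /andP[n_gt1 _].
      by rewrite gtn_eqF // !mul0r.
    by rewrite addr0 /class_fun cls1 eqxx divr1 mul1r mulrC.
  rewrite /mangoldt_sum -big_split /=; apply: eq_big_nat => n /andP[n_gt0 _].
  rewrite -!mulrDl -sum_moebius_ln // !mulr_suml.
  rewrite big_seq [RHS]big_seq; apply: eq_bigr => d; rewrite -dvdn_divisors // => d_n.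
  rewrite [(d * _)%N]mulnC divnK // -{1}(divnK d_n) natrM invfM; ring.
apply: le_trans (ler_norm_sum _ _ _) _.
have N_gt0' : 0 < N%:R :> R by rewrite ltr0n.
apply: (@le_trans _ _ (A / N%:R * \sum_(1 <= n < N.+1) (ln N%:R - ln n%:R))); last first.
  rewrite mulrAC ler_pdivrMr // ler_wpM2l //; exact: sum_ln_ratio.
rewrite mulr_sumr big_seq [leRHS]big_seq; apply: ler_sum => d.
rewrite mem_index_iota => /andP[d_gt0 d_N].
have d_gt0' : 0 < d%:R :> R by rewrite ltr0n.
have ln_ge0' : 0 <= ln N%:R - ln d%:R :> R by rewrite subr_ge0 ler_ln_nat.
have inner : `|\sum_(1 <= k < (N %/ d).+1) class_fun f (d * k) / k%:R| <= A * (d%:R / N%:R).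
  have := lP f0 d (N %/ d); have -> : class_fun (conv l f) d = 0.
    by rewrite /class_fun; case: (cls d).
  by rewrite subr0 => /le_trans -> //; rewrite ler_wpM2l // inv_divS.
rewrite !normrM (ger0_norm ln_ge0') normfV (ger0_norm (ltW d_gt0')).
have -> : A / N%:R * (ln N%:R - ln d%:R) =
   1 / d%:R * (ln N%:R - ln d%:R) * (A * (d%:R / N%:R)).
  by field; rewrite !lt0r_neq0.
apply: ler_pM => //; first by rewrite !mulr_ge0 // invr_ge0 ltW.
by rewrite ler_wpM2r // ler_wpM2r ?invr_ge0 ?(ltW d_gt0') // norm_moebius.
Qed.

Lemma mangoldt_sum_one : exists C, forall N, (0 < N)%N -> `|mangoldt_sum (fun=> 1) N - ln
  N%:R| <= C.
Proof.
exists (4 + C0) => N N_gt0; have := mertens R N_gt0.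
rewrite (bigID (fun n => cls n == None)) /=.
have -> : \sum_(1 <= n < N.+1 | cls n != None) L n / n%:R = mangoldt_sum (fun=> 1) N.
  rewrite big_mkcond; apply: eq_bigr => n _.
  by rewrite /class_fun; case: (cls n) => [g|] /=; rewrite ?mulr1 ?mulr0.
have := cls_none N.
have : 0 <= \sum_(1 <= n < N.+1 | cls n == None) L n / n%:R.
  by apply: sumr_ge0 => n _; rewrite divr_ge0 ?vonmangoldt_ge0.
set S := \sum_(_ <= _ < _ | _) _; set P := mangoldt_sum _ _.
by rewrite !ler_norml => h1 h2 /andP[h3 h4]; apply/andP; split; lra.
Qed.

(** Let a be the mean of f, which is also that of w. Then f is k plus the image of w - a plus the
    constant a, and these contribute - k(1) ln N, 0 and a ln N up to O(1). *)
Lemma mangoldt_sum_decomposed f k w :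
  (forall g, f g = k g + conv l w g) -> (forall g, conv l k g = 0) ->
  exists C, forall N, (0 < N)%N ->
    `|mangoldt_sum f N - ((\sum_g f g) / #|gT|%:R - k 1%g) * ln N%:R| <= C.
Proof.
move=> fE lk; have k0 : \sum_g k g = 0 by rewrite -sum_conv big1.
have n_neq0 : #|gT|%:R != 0 :> R.
  by rewrite pnatr_eq0 -lt0n; apply/card_gt0P; exists 1%g.
have sum_f : \sum_g f g = \sum_g w g.
  by under eq_bigr do rewrite fE; rewrite big_split /= k0 add0r sum_conv.
set a := (\sum_g f g) / #|gT|%:R.
have w0 : \sum_g (w g - a) = 0.
  by rewrite sumrB sumr_const -mulr_natr /a sum_f divfK // subrr.
have [C1 C1P] := mangoldt_sum_ker lk; have [C2 C2P] := mangoldt_sum_conv w0;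
  have [C3 C3P] := mangoldt_sum_one.
exists (C1 + C2 + `|a| * C3) => N N_gt0.
have -> : mangoldt_sum f N = mangoldt_sum k N + 1 * mangoldt_sum (conv l (fun g => w g - a)) N
  + a * mangoldt_sum (fun=> 1) N.
  rewrite -!mangoldt_sum_lin; apply: eq_mangoldt_sum => g.
  rewrite fE -addrA; congr (_ + _); rewrite mulr1 mul1r /conv.
  under [X in _ = X + _]eq_bigr do rewrite mulrBr.
  by rewrite sumrB -mulr_suml sum_l mul1r subrK.
rewrite mul1r (_ : _ - _ = (mangoldt_sum k N + k 1%g * ln N%:R) + mangoldt_sum (conv l (fun g
  => w g - a)) N
   + a * (mangoldt_sum (fun=> 1) N - ln N%:R)); last by ring.
apply: le_trans (ler_normD _ _) _; apply: lerD; last by rewrite normrM ler_wpM2l // C3P.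
by apply: le_trans (ler_normD _ _) _; apply: lerD; [exact: C1P | exact: C2P].
Qed.

Lemma ker_trivial k w :
  (forall g, (g == 1%g)%:R = k g + conv l w g) -> (forall g, conv l k g = 0) ->
  forall g, k g = 0.
Proof.
move=> dec lk; have rep := delta_ker_reproducing mulC dec lk.
have n_gt0 : 0 < #|gT|%:R :> R by rewrite ltr0n; apply/card_gt0P; exists 1%g.
have sum_d : \sum_(g : gT) (g == 1%g)%:R = 1 :> R.
  by rewrite (bigD1 (1%g : gT)) //= eqxx big1 ?addr0 // => g /negPf->.
have k1_le : k 1%g <= #|gT|%:R^-1.
  have [C CP] := mangoldt_sum_decomposed dec lk; rewrite sum_d mul1r in CP.
  rewrite -subr_ge0 leNgt; apply/negP; set s := _ - _ in CP *; move=> s_lt0.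
  have [N N_gt0 HN] := ln_nat_unbounded (C / - s).
  have := CP N N_gt0; rewrite ler_norml => /andP[_].
  have P_ge0 : 0 <= mangoldt_sum (fun g => (g == 1%g)%:R) N by apply: mangoldt_sum_ge0 => g.
  move: HN; rewrite ltr_pdivrMr ?oppr_gt0 //; lra.
have [k1_0|k1_neq0] := eqVneq (k 1%g) 0.
  apply: sum_sqr_eq0; rewrite -[RHS]k1_0 -rep.
  by apply: eq_bigr => h _; rewrite mul1g.
have [chi [chi_pm chiM kE]] := reproducing_sign rep k1_le k1_neq0.
have chi1 : chi 1%g = 1.
  have := chiM 1%g 1%g; rewrite mulg1; case: (chi_pm 1%g) => -> //; lra.
have lchi g : conv l chi g = 0.
  have := lk g; rewrite (eq_conv _ kE) /conv; under eq_bigr do rewrite mulrA.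
  by rewrite -mulr_suml => /eqP; rewrite mulf_eq0 invr_eq0 (negPf (lt0r_neq0 n_gt0)) orbF => /eqP.
have chi0 : \sum_g chi g = 0 by rewrite -sum_conv big1.
(* [lP] at d = 1 turns [conv l chi = 0] into the vanishing of the L-series of chi at 1, with the
   required rate. *)
exfalso; apply: (@real_character_series_neq0 R (class_fun chi) (nrm chi * B) (nrm chi * B)).
- move=> a b; rewrite /class_fun clsM; case: (cls a) => [x|] /=; last by rewrite mul0r.
  by case: (cls b) => [y|] /=; rewrite ?chiM ?mulr0.
- by rewrite /class_fun cls1.
- by move=> n; rewrite /class_fun; case: (cls n) => [g|]; [case: (chi_pm g) => ->;
  [apply: Or32|apply: Or33]|apply: Or31].
- by move=> c; exact: class_fun_interval_sum.
move=> K; have := lP chi0 1%N K;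
  have -> : class_fun (conv l chi) 1%N = 0 by rewrite /class_fun cls1.
by rewrite subr0; under eq_bigr do rewrite mul1n.
Qed.

(** The kernel component being 0, delta_1 lies in the image, and so do its translates. *)
Lemma mangoldt_sum_indicator a : exists C, forall N, (0 < N)%N ->
  `|mangoldt_sum (fun g => (g == a)%:R) N - ln N%:R / #|gT|%:R| <= C.
Proof.
have [k [w [dec lk]]] := delta_decomposition mulC l.
have k0 := ker_trivial dec lk.
have dec_a g : (g == a)%:R = 0 + conv l (fun x => w (a^-1 * x)%g) g.
  rewrite conv_translate -[0](k0 (a^-1 * g)%g) -dec.
  by rewrite -(inj_eq (mulgI a^-1%g)) mulVg.
have [|C CP] := mangoldt_sum_decomposed dec_a.
  by move=> g; rewrite /conv big1 // => h _; rewrite mulr0.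
exists C => N /CP; rewrite subr0 (bigD1 a) //= eqxx big1 ?addr0 => [|g /negPf->//].
by rewrite mul1r mulrC.
Qed.

End Dirichlet.

(** * Residue classes modulo m and the primes in them *)

Lemma count_residue_period m c a : (0 < m)%N ->
  (\sum_(a <= i < a + m) (i == c %[mod m]))%N = 1%N.
Proof.
move=> m_gt0; elim: a => [|a IH].
  rewrite add0n big_mkord (bigD1 (Ordinal (ltn_pmod c m_gt0))) //= modn_mod eqxx.
  rewrite big1 // => i; rewrite -val_eqE /= => /negPf.
  by rewrite (modn_small (ltn_ord i)) => ->.
case: m m_gt0 IH => // m _; rewrite big_ltn ?leq_addr //; last by lia.
rewrite addSn big_nat_recr //=; last by lia.
by rewrite [in X in _ -> (_ + X)%N = _]modnDr addnC addnS.
Qed.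

Lemma count_residue m c a n : (0 < m)%N ->
  (n %/ m <= \sum_(a <= i < a + n) (i == c %[mod m]) <= (n %/ m).+1)%N.
Proof.
move=> m_gt0; rewrite {2 3}(divn_eq n m); elim: (n %/ m)%N a => [|q IH] a.
  rewrite mul0n add0n leq0n /= -(count_residue_period c a m_gt0).
  rewrite [leqRHS](big_cat_nat _ (n := (a + n %% m)%N)) ?leq_addr //=.
  by rewrite leq_add2l ltnW // ltn_pmod.
rewrite (big_cat_nat _ (n := (a + m)%N)) ?leq_addr //=; last by rewrite mulSn; lia.
rewrite count_residue_period // add1n !ltnS.
by have := IH (a + m)%N; rewrite mulSn !addnA.
Qed.

Section PrimesInProgressions.
Variable R : realType.
Local Notation L := (@vonmangoldt R).

Definition residue_unit m n : option {unit 'Z_m} := insub (n%:R : 'Z_m).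

Lemma residue_unitM m a b : residue_unit m (a * b) =
  obind (fun x => omap (fun y => (x * y)%g) (residue_unit m b)) (residue_unit m a).
Proof.
rewrite /residue_unit natrM; case: (insubP _ (a%:R : 'Z_m)) => [x xU def_x|aU] /=.
  case: (insubP _ (b%:R : 'Z_m)) => [y yU def_y|bU] /=.
    by rewrite -def_x -def_y -[val x * val y]/(val (x * y)%g) valK.
  by rewrite insubN // unitrM negb_and bU orbT.
by rewrite insubN // unitrM negb_and aU.
Qed.

Lemma residue_unit_eq m n a g : (1 < m)%N -> residue_unit m a = Some g ->
  (residue_unit m n == Some g) = (n == a %[mod m]).
Proof.
move=> m_gt1; rewrite /residue_unit; case: insubP => // x xU def_x [<-] {g}.
rewrite -!val_Zp_nat // val_eqE -def_x; apply/eqP/eqP => [|->]; last by rewrite valK.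
by case: insubP => // y yU def_y [<-].
Qed.

Lemma residue_unit_none m n : (1 < m)%N -> (residue_unit m n == None) = ~~ coprime m n.
Proof.
by move=> m_gt1; rewrite /residue_unit -unitZpE //; case: insubP => [x -> //|/negPf->].
Qed.

Lemma residue_unit_equidistributed m g a b : (1 < m)%N ->
  `|\sum_(a <= i < b) ((residue_unit m i == Some g)%:R - (residue_unit m i == Some 1%g)%:R)|
     <= 1 :> R.
Proof.
move=> m_gt1; have m_gt0 := ltnW m_gt1.
pose rep (h : {unit 'Z_m}) : nat := nat_of_ord (FinRing.uval h).
have natK h : residue_unit m (rep h) = Some h.
  by rewrite /residue_unit natr_Zp valK.
have [b_a|a_b] := leqP b a; first by rewrite big_geq // normr0.
have cnt (h : {unit 'Z_m}) : (\sum_(a <= i < b) (residue_unit m i == Some h)%:R : R) =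
    (\sum_(a <= i < a + (b - a)) (i == rep h %[mod m]))%N%:R.
  rewrite natr_sum subnKC ?(ltnW a_b) //; apply: eq_bigr => i _.
  by rewrite (residue_unit_eq i m_gt1 (natK h)).
rewrite sumrB !cnt.
have /andP[l1 u1] := count_residue (rep g) a (b - a) m_gt0.
have /andP[l2 u2] := count_residue (rep 1%g) a (b - a) m_gt0.
move: l1 u1 l2 u2; rewrite -!(ler_nat R) -natr1.
by rewrite ler_norml => *; apply/andP; split; lra.
Qed.

(** A prime not coprime to m divides m, hence is at most m; the composite n contribute at most 2. *)
Lemma residue_unit_none_sum m N : (1 < m)%N ->
  \sum_(1 <= n < N.+1 | residue_unit m n == None) L n / n%:R <=
  2 + \sum_(1 <= n < m.+1) L n / n%:R.
Proof.
move=> m_gt1; have t_ge0 n : 0 <= L n / n%:R by rewrite divr_ge0 ?vonmangoldt_ge0.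
rewrite (bigID prime) /= addrC; apply: lerD.
  apply: le_trans (sum_composite_vonmangoldt R N).
  by rewrite [leRHS](bigID (fun n => residue_unit m n == None)) /=
    (eq_bigl _ _ (fun n => andbC _ _)) lerDl sumr_ge0.
rewrite -big_filter; apply: (@ler_sum_onto _ _ _ _ _ _ _ id); rewrite ?filter_uniq ?iota_uniq //.
move=> n; rewrite mem_filter mem_index_iota residue_unit_none // => /andP[/andP[m_n n_pr] n_N].
exists n => //; rewrite mem_index_iota prime_gt0 //= ltnS.
by apply: dvdn_leq; [exact: ltnW | rewrite coprime_sym prime_coprime // negbK in m_n].
Qed.

Theorem dirichlet m a : (1 < m)%N -> coprime m a -> exists C : R, forall N, (0 < N)%N ->
  `|\sum_(1 <= p < N.+1 | prime p && (p == a %[mod m])) ln p%:R / p%:R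
     - ln N%:R / (totient m)%:R| <= C.
Proof.
move=> m_gt1 co_ma.
have [g def_g] : exists g, residue_unit m a = Some g.
  by case E: (residue_unit m a) => [g|]; [exists g | move/eqP: E;
    rewrite residue_unit_none // co_ma].
have mC : commutative (@mulg {unit 'Z_m}) by exact: unit_Zp_mulgC.
have cM := @residue_unitM m.
have c1 : residue_unit m 1 = Some 1%g by rewrite /residue_unit -[RHS](valK (1%g : {unit 'Z_m})).
have ceq h b c := residue_unit_equidistributed h b c m_gt1.
have cn N := residue_unit_none_sum N m_gt1.
have [l [sum_l lP]] := class_fun_series cM ceq.
have [C CP] := @mangoldt_sum_indicator R {unit 'Z_m} _ _ _ mC cM c1 ceq cn l sum_l lP g.
exists (C + 2) => N N_gt0; have := CP N N_gt0.
rewrite -cardsT -[#|_|]/(#|units_Zp m|) card_units_Zp; last exact: ltnW.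
have -> : mangoldt_sum (residue_unit m) (fun h => (h == g)%:R) N =
    \sum_(1 <= n < N.+1 | n == a %[mod m]) L n / n%:R.
  rewrite [RHS]big_mkcond; apply: eq_bigr => n _;
    rewrite -(residue_unit_eq n m_gt1 def_g) /class_fun.
  case: (residue_unit m n) => [h|]; last by rewrite mulr0.
  by rewrite (_ : (Some h == Some g) = (h == g)) //; case: eqP; rewrite ?mulr1 ?mulr0.
rewrite (bigID prime) /=.
have -> : \sum_(1 <= n < N.+1 | (n == a %[mod m]) && prime n) L n / n%:R =
   \sum_(1 <= p < N.+1 | prime p && (p == a %[mod m])) ln p%:R / p%:R.
  rewrite (eq_bigl _ _ (fun n => andbC _ _)); apply: eq_bigr => p /andP[p_pr _].
  by rewrite vonmangoldt_prime.
set S := \sum_(_ <= _ < _ | _) ln _ / _; set T := \sum_(_ <= _ < _ | _) _.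
have t_ge0 n : 0 <= L n / n%:R by rewrite divr_ge0 ?vonmangoldt_ge0.
have T_ge0 : 0 <= T by rewrite sumr_ge0.
have T_le : T <= 2.
  apply: le_trans (sum_composite_vonmangoldt R N).
  rewrite [leRHS](bigID (fun n => n == a %[mod m])) /= /T (eq_bigl _ _ (fun n => andbC _ _)).
  by rewrite lerDl sumr_ge0.
by rewrite !ler_norml => /andP[h1 h2]; apply/andP; split; lra.
Qed.

End PrimesInProgressions.

(** * Selberg's sieve *)

Lemma squarefree_part n : (0 < n)%N ->
  exists l m, [/\ (0 < l)%N, (0 < m)%N, squarefree l & n = (l * m ^ 2)%N].
Proof.
(* The induction also carries l | n, so that the new prime does not divide l. *)
suff : (0 < n)%N -> exists l m, [/\ (0 < l)%N, (0 < m)%N, squarefree l & n = (l * m ^ 2)%N]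
    /\ (l %| n)%N by move=> h /h[l [m [? _]]]; exists l, m.
move: n; apply: pfactor_ind => [|p e n p_pr e_gt0 n_gt0 p_n [l [m [[l_gt0 m_gt0 sq_l def_n]
  l_n]]]].
  by exists 1%N, 1%N.
have p_gt0 := prime_gt0 p_pr; have p_l : ~~ (p %| l)%N.
  by apply: contra p_n => /dvdn_trans; apply.
have [e_odd|e_even] := boolP (odd e).
  exists (p * l)%N, (p ^ e./2 * m)%N; split; first split.
  - by rewrite muln_gt0 p_gt0.
  - by rewrite muln_gt0 expn_gt0 p_gt0.
  - rewrite squarefreeM ?prime_coprime // sq_l andbT.
    by rewrite /squarefree primes_prime //= logn_prime // eqxx.
  - rewrite -{1}(odd_double_half e) e_odd add1n expnS def_n expnMn -expnM muln2; lia.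
  by apply: dvdn_mul => //; rewrite -{1}(expn1 p) dvdn_exp2l.
exists l, (p ^ e./2 * m)%N; split; last exact: dvdn_mull.
split=> //; first by rewrite muln_gt0 expn_gt0 p_gt0.
rewrite -{1}(odd_double_half e) (negPf e_even) add0n def_n expnMn -expnM muln2; lia.
Qed.

Section SelbergSieve.
Variables (R : realType) (r z : nat).
Hypothesis r_pr : prime r.
Hypothesis z_gt0 : (0 < z)%N.
Local Notation mu := (@moebius R).

(** The sieve counts primes n with r | n + 1. Moduli prime to r make the conditions r | n + 1 and d
    | n independent. *)
Definition sieve_support := [seq l <- index_iota 1 z.+1 | squarefree l && coprime r l].
Local Notation LL := sieve_support.

Definition sieve_mass : R := \sum_(l <- LL) (totient l)%:R^-1.
Local Notation G := sieve_mass.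

Let S d : R := \sum_(l <- LL | (d %| l)%N) (totient l)%:R^-1.

Definition selberg_weight d : R := mu d * d%:R * S d / G.
Local Notation lam := selberg_weight.

Lemma mem_sieve_support l :
  (l \in LL) = [&& (0 < l)%N, (l <= z)%N, squarefree l & coprime r l].
Proof. by rewrite mem_filter mem_index_iota ltnS andbC -!andbA. Qed.

Lemma sieve_mass_gt0 : 0 < G.
Proof.
have one_in : 1%N \in LL by rewrite mem_sieve_support z_gt0 coprimen1.
rewrite /G (big_rem 1%N) //= invr1 (lt_le_trans ltr01) // lerDl sumr_ge0 // => l _.
by rewrite invr_ge0.
Qed.

Lemma selberg_weight1 : lam 1 = 1.
Proof.
rewrite /lam moebius1 !mul1r (_ : S 1 = G) ?divff ?lt0r_neq0 ?sieve_mass_gt0 //.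
by apply: eq_bigl => l; rewrite dvd1n.
Qed.

Lemma selberg_weight_coprime d : lam d != 0 -> coprime r d.
Proof.
apply: contraNT => r_d; rewrite /lam (_ : S d = 0) ?mulr0 ?mul0r //.
rewrite /S big1_seq // => l /andP[d_l]; rewrite mem_sieve_support => /and4P[_ _ _ r_l].
by rewrite (coprime_dvdr d_l r_l) in r_d.
Qed.

(** This is cruder than the classical bound 1; it costs a remainder z^4, harmless for the small z
    used later. *)
Lemma norm_selberg_weight d : `|lam d| <= d%:R.
Proof.
have G_gt0 := sieve_mass_gt0.
have S_ge0 : 0 <= S d by rewrite sumr_ge0 // => l _; rewrite invr_ge0.
have S_G : S d <= G.
  rewrite /G [leRHS](bigID (fun l => d %| l)%N) /= lerDl sumr_ge0 // => l _.
  by rewrite invr_ge0.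
rewrite /lam normrM normfV (gtr0_norm G_gt0) ler_pdivrMr // !normrM (ger0_norm S_ge0) normr_nat.
apply: ler_pM => //; first by rewrite mulr_ge0.
by rewrite -[leRHS]mul1r ler_wpM2r // norm_moebius.
Qed.

(** After interchanging the sums, the inner sum of mu d over f | d | l is mu f if l = f and 0
    otherwise. *)
Lemma selberg_transform f : (0 < f)%N ->
  \sum_(1 <= d < z.+1 | (f %| d)%N) lam d / d%:R =
  (f \in LL)%:R * mu f / ((totient f)%:R * G).
Proof.
move=> f_gt0; have G_gt0 := sieve_mass_gt0.
transitivity (\sum_(l <- LL) \sum_(1
  <= d < z.+1 | (d %| l)%N) (f %| d)%:R * (mu d / (totient l)%:R / G)).
  rewrite [RHS](exchange_big_dep xpredT) //= [LHS]big_mkcond /=;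
    apply: eq_big_nat => d /andP[d_gt0 _].
  case: (f %| d)%N; last by rewrite big1 // => l _; rewrite mul0r.
  rewrite /lam /S mulr_sumr !mulr_suml; apply: eq_bigr => l _.
  have d_neq0 : d%:R != 0 :> R by rewrite pnatr_eq0 -lt0n.
  by rewrite mul1r; move: (_%:R^-1 : R) => c; field; rewrite d_neq0 lt0r_neq0.
rewrite (eq_big_seq (fun l => (l == f)%:R * (mu f / ((totient f)%:R * G)))); last first.
  move=> l; rewrite mem_sieve_support => /and4P[l_gt0 l_z sq_l _].
  rewrite -(@sum_divisors_nat _ z l) ?l_gt0 //.
  rewrite (eq_bigr (fun d => (f %| d)%:R * mu d * ((totient l)%:R^-1 / G))); last first.
    by move=> d _; rewrite !mulrA.
  rewrite -mulr_suml (eq_bigr (fun d => if (f %| d)%N then mu d else 0)); last first.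
    by move=> d _; case: ifP; rewrite ?mul1r ?mul0r.
  rewrite -big_mkcond sum_moebius_above // eq_sym; case: eqP => [->|];
    rewrite ?mul0r ?mulr0 ?mul0r //.
  by rewrite mulr1 mul1r invfM.
rewrite -mulr_suml mulrA; congr (_ * _ / _).
have uLL : uniq LL by rewrite filter_uniq ?iota_uniq.
case: (boolP (f \in LL)) => fL.
  by rewrite (bigD1_seq f) //= eqxx big1 ?addr0 // => l /negPf->.
rewrite big1_seq // => l /andP[_ lL]; case: eqP => // lf; by rewrite -lf lL in fL.
Qed.

(** 1 / lcm = gcd / (d e), and the gcd is the sum of phi over the common divisors; this diagonalises
    the quadratic form. *)
Lemma inv_lcm_sum d e : (0 < d <= z)%N -> (0 < e)%N ->
  (lcmn d e)%:R^-1 = d%:R^-1 * e%:R^-1 *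
    \sum_(1 <= f < z.+1) (totient f)%:R * ((f %| d)%:R * (f %| e)%:R) :> R.
Proof.
move=> /andP[d_gt0 d_z] e_gt0.
have g_gt0 : (0 < gcdn d e)%N by rewrite gcdn_gt0 d_gt0.
have -> : \sum_(1 <= f < z.+1) (totient f)%:R * ((f %| d)%:R * (f %| e)%:R) = (gcdn d e)%:R :> R.
  rewrite -[in RHS](sum_totient g_gt0) (@sum_divisors_nat _ z) ?g_gt0 /=; last first.
    by rewrite (leq_trans _ d_z) // dvdn_leq // dvdn_gcdl.
  rewrite natr_sum [RHS]big_mkcond; apply: eq_bigr => f _.
  by rewrite dvdn_gcd -natrM mulnb; case: (_ && _); rewrite ?mulr1 ?mulr0.
have := muln_lcm_gcd d e => /(congr1 (fun n => n%:R : R)); rewrite !natrM => def_de.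
have n1 : d%:R != 0 :> R by rewrite pnatr_eq0 -lt0n.
have n2 : e%:R != 0 :> R by rewrite pnatr_eq0 -lt0n.
have n3 : (lcmn d e)%:R != 0 :> R by rewrite pnatr_eq0 -lt0n lcmn_gt0 d_gt0.
by rewrite -invfM -def_de invfM -mulrA mulVf ?mulr1 // pnatr_eq0 -lt0n.
Qed.

Lemma selberg_quadratic_form :
  \sum_(1 <= d < z.+1) \sum_(1 <= e < z.+1) lam d * lam e / (lcmn d e)%:R = G^-1.
Proof.
have G_gt0 := sieve_mass_gt0.
pose u f := \sum_(1 <= d < z.+1 | (f %| d)%N) lam d / d%:R.
transitivity (\sum_(1 <= f < z.+1) (totient f)%:R * (u f * u f)).
  transitivity (\sum_(1 <= d < z.+1) \sum_(1 <= e < z.+1) \sum_(1 <= f < z.+1)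
      (totient f)%:R * (((f %| d)%:R * (lam d / d%:R)) * ((f %| e)%:R * (lam e / e%:R)))).
    apply: eq_big_nat => d d_z; apply: eq_big_nat => e /andP[e_gt0 _].
    rewrite inv_lcm_sum // !mulr_sumr; apply: eq_bigr => f _; ring.
  under eq_bigr do rewrite exchange_big.
  rewrite exchange_big; apply: eq_bigr => f _.
  have uE : u f = \sum_(1 <= d < z.+1) (f %| d)%:R * (lam d / d%:R).
    by rewrite /u big_mkcond; apply: eq_bigr => d _; case: ifP; rewrite ?mul1r ?mul0r.
  rewrite uE mulr_suml mulr_sumr; apply: eq_bigr => d _.
  by rewrite -!mulr_sumr.
transitivity (\sum_(1 <= f < z.+1 | squarefree f && coprime r f) (totient f)%:R^-1 / G ^+ 2).
  rewrite [RHS]big_mkcond; apply: eq_big_nat => f /andP[f_gt0 f_z].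
  rewrite /u selberg_transform // mem_sieve_support f_gt0 -ltnS f_z /=.
  case: ifP => [/andP[sq_f _]|_]; last by rewrite !mul0r mulr0.
  have := sqr_moebius R sq_f; rewrite expr2 => mu2.
  have t_neq0 : (totient f)%:R != 0 :> R by rewrite pnatr_eq0 -lt0n totient_gt0.
  rewrite mul1r mulf_div mu2; field; rewrite t_neq0 lt0r_neq0 //.
rewrite -mulr_suml -big_filter -/LL -/G; field; exact: lt0r_neq0.
Qed.

Lemma count_sieve_class A X D : coprime r D -> (0 < D)%N ->
  `|\sum_(A <= n < A + X) (r %| n.+1)%:R * (D %| n)%:R - X%:R / r%:R / D%:R| <= 1 :> R.
Proof.
move=> r_D D_gt0; have r_gt0 := prime_gt0 r_pr.
have rD_gt0 : (0 < r * D)%N by rewrite muln_gt0 r_gt0.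
have cls n : (r %| n.+1)%N && (D %| n)%N = (n == chinese r D r.-1 0 %[mod r * D]).
  rewrite chinese_remainder // chinese_modl // chinese_modr // mod0n.
  rewrite -[(D %| n)%N]/(n %% D == 0)%N; congr (_ && _).
  rewrite -[n in RHS]addn0 -(eqn_modDr 1) addn0 !addn1 prednK // modnn //.
rewrite (eq_bigr (fun n => (n == chinese r D r.-1 0 %[mod r * D])%:R)); last first.
  by move=> n _; rewrite -cls -natrM mulnb.
rewrite -natr_sum; have /andP[] := count_residue (chinese r D r.-1 0) A X rD_gt0.
rewrite -(ler_nat R) -[in X in _ -> X -> _](ler_nat R) -natr1; set Q := (_ %/ _)%N;
  set T := (\sum_(_ <= _ < _) _)%N.
have rD0 : 0 < (r * D)%:R :> R by rewrite ltr0n.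
have XQ : X%:R / r%:R / D%:R < Q%:R + 1 :> R.
  by rewrite -mulrA -invfM -natrM ltr_pdivrMr // natr1 -natrM ltr_nat ltn_ceil.
have QX : Q%:R <= X%:R / r%:R / D%:R :> R.
  by rewrite -mulrA -invfM -natrM ler_pdivlMr // -natrM ler_nat leq_trunc_div.
by move=> h1 h2; rewrite ler_norml; apply/andP; split; lra.
Qed.

(** A prime n >= A > z has no divisor in [2, z], so the squared sum of weights is 1 there. Expanding
    the square, each of the z^2 pairs (d, e) has a counting error at most 1 and a weight at most
    z^2. *)
Lemma selberg_upper_bound A X : (z < A)%N ->
  (\sum_(A <= n < A + X) (prime n && (r %| n.+1)%N)%:R : R) <= X%:R / r%:R / G + (z ^ 4)%:R.
Proof.
move=> z_A; have G_gt0 := sieve_mass_gt0.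
apply: (@le_trans _ _ (\sum_(A <= n < A + X) (r %| n.+1)%:R *
    (\sum_(1 <= d < z.+1) lam d * (d %| n)%:R) ^+ 2)).
  rewrite big_seq [leRHS]big_seq; apply: ler_sum => n; rewrite mem_index_iota => /andP[A_n _].
  case: (boolP (prime n)) => n_pr; last by rewrite mulr_ge0 ?sqr_ge0.
  rewrite /= big_ltn // dvd1n selberg_weight1 big1_seq ?addr0 ?mulr1 ?expr1n ?mulr1 //.
  move=> d /andP[_]; rewrite mem_index_iota => /andP[d_gt1 d_z].
  case: (boolP (d %| n)%N) => [d_n|_]; last by rewrite mulr0.
  have /primeP[_ /(_ d d_n)] := n_pr; lia.
rewrite (eq_bigr (fun n => \sum_(1 <= d < z.+1) \sum_(1 <= e < z.+1)
   lam d * lam e * ((r %| n.+1)%:R * (lcmn d e %| n)%:R))); last first.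
  move=> n _; rewrite expr2 mulr_suml mulr_sumr; apply: eq_bigr => d _.
  rewrite !mulr_sumr; apply: eq_bigr => e _.
  by rewrite dvdn_lcm -mulnb natrM; ring.
rewrite exchange_big; under eq_bigr do rewrite exchange_big.
have -> : X%:R / r%:R / G = \sum_(1 <= d < z.+1) \sum_(1 <= e < z.+1)
    lam d * lam e * (X%:R / r%:R / (lcmn d e)%:R).
  rewrite -selberg_quadratic_form mulr_sumr; apply: eq_bigr => d _.
  by rewrite mulr_sumr; apply: eq_bigr => e _; rewrite mulrCA mulrA.
have -> : (z ^ 4)%:R = \sum_(1 <= d < z.+1) \sum_(1 <= e < z.+1) (z ^ 2)%:R :> R.
  by rewrite !sumr_const_nat subn1 -!mulrnA mulnn -expnD.
rewrite -big_split big_seq [leRHS]big_seq; apply: ler_sum => d;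
  rewrite mem_index_iota => /andP[d_gt0 d_z].
rewrite -big_split big_seq [leRHS]big_seq; apply: ler_sum => e;
  rewrite mem_index_iota => /andP[e_gt0 e_z] /=.
rewrite -mulr_sumr; have [->|ld] := eqVneq (lam d) 0; first by rewrite !mul0r add0r.
have [->|le] := eqVneq (lam e) 0; first by rewrite !(mulr0, mul0r) add0r.
rewrite -lerBlDl -mulrBr (le_trans (ler_norm _)) // normrM normrM.
have co : coprime r (lcmn d e).
  have := selberg_weight_coprime ld; have := selberg_weight_coprime le.
  rewrite !prime_coprime // => re rd; apply/negP => r_lcm.
  have : (r %| d * e)%N by rewrite -muln_lcm_gcd dvdn_mulr.
  by rewrite Euclid_dvdM // (negPf re) (negPf rd).
have lcm_gt0 : (0 < lcmn d e)%N by rewrite lcmn_gt0 d_gt0.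
rewrite -[leRHS]mulr1; apply: ler_pM => //; last exact: count_sieve_class.
  by rewrite mulr_ge0.
rewrite expnS expn1 natrM; apply: ler_pM => //.
  by rewrite (le_trans (norm_selberg_weight d)) // ler_nat.
by rewrite (le_trans (norm_selberg_weight e)) // ler_nat.
Qed.

Lemma sum_inv_sqr N : \sum_(1 <= m < N.+1) (m ^ 2)%:R^-1 <= 2 :> R.
Proof.
suff : \sum_(1 <= m < N.+2) (m ^ 2)%:R^-1 <= 2 - N.+1%:R^-1 :> R.
  move=> hs; apply: le_trans (le_trans hs _); last by rewrite gerBl invr_ge0.
  by rewrite [leRHS]big_nat_recr //= lerDl invr_ge0.
elim: N => [|N IH]; first by rewrite big_nat1 invr1; lra.
rewrite big_nat_recr //=; apply: le_trans (lerD IH (lexx _)) _.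
rewrite natrX -[N.+2%:R]natr1; set x := N.+1%:R; have x_ge1 : 1 <= x :> R by rewrite ler1n.
have -> : 2 - (x + 1)^-1 = 2 - x^-1 + (x * (x + 1))^-1.
  by field; rewrite !lt0r_neq0 //; lra.
rewrite lerD2l lef_pV2 ?posrE ?exprn_gt0 ?mulr_gt0; [nra|lra..].
Qed.

(** Every n <= z is l r^b m^2 with l in the support and b = 0 or 1. As 1/l <= 1/phi(l), the harmonic
    sum is at most G (1 + 1/r) times the sum of 1/m^2, hence at most 4 G. *)
Lemma sieve_mass_lb : ln z%:R <= 4 * G.
Proof.
have r_gt0 := prime_gt0 r_pr; have r_gt1 := prime_gt1 r_pr.
apply: (@le_trans _ _ (\sum_(1 <= n < z.+1) (n%:R^-1 : R))).
  by apply: le_trans (harmonic_lb R z); rewrite ler_ln_nat.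
pose H (j : nat * (bool * nat)) : R := (j.1)%:R^-1 * ((r ^ j.2.1)%:R^-1 * (j.2.2 ^ 2)%:R^-1).
apply: (@le_trans _ _ (\sum_(j <- [seq (l, bm) | l <- LL, bm <-
    [seq (b, m) | b <- [:: false; true], m <- index_iota 1 z.+1]]) H j)).
  apply: (@ler_sum_onto R nat (nat * (bool * nat))%type _ _ _ H
    (fun j => (j.1 * (r ^ j.2.1 * j.2.2 ^ 2))%N)).
  - exact: iota_uniq.
  - by move=> j _; rewrite !mulr_ge0 ?invr_ge0.
  move=> n; rewrite mem_index_iota ltnS => /andP[n_gt0 n_z].
  have [l [m [l_gt0 m_gt0 sq_l def_n]]] := squarefree_part n_gt0.
  have l_n : (l <= n)%N by rewrite def_n leq_pmulr // expn_gt0 m_gt0.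
  have m_n : (m <= n)%N.
    by rewrite def_n (leq_trans _ (leq_pmull _ l_gt0)) // -{1}(expn1 m) leq_pexp2l.
  suff [l' [b [l'_LL def_l]]] : exists l' (b : bool), l' \in LL /\ l = (l' * r ^ b)%N.
    exists (l', (b, m)); last first.
      by rewrite /H /= -!invfM -!natrM mulnA -def_l -def_n.
    apply/allpairsP; exists (l', (b, m)); split => //; apply/allpairsP.
    by exists (b, m); rewrite mem_index_iota m_gt0 ltnS (leq_trans m_n n_z); split => //;
      case: (b).
  have [r_l|r_l] := boolP (r %| l)%N; last first.
    exists l, false; rewrite expn0 muln1 mem_sieve_support l_gt0 sq_l prime_coprime // r_l.
    by rewrite (leq_trans l_n n_z).
  have def_l : l = (l %/ r * r)%N by rewrite divnK.
  have l'_gt0 : (0 < l %/ r)%N by rewrite divn_gt0 // dvdn_leq.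
  exists (l %/ r)%N, true; rewrite expn1; split => //; rewrite mem_sieve_support l'_gt0.
  rewrite (leq_trans (leq_div _ _)) ?(leq_trans l_n n_z) //=.
  rewrite (squarefree_dvd l_gt0 _ sq_l); last by rewrite {2}def_l dvdn_mulr.
  by rewrite coprime_sym squarefree_coprime -?def_l.
rewrite big_allpairs_dep.
under eq_bigr do rewrite big_allpairs_dep big_cons big_seq1 /H /= -!mulr_sumr -mulrDr.
rewrite -mulr_suml mulrC; apply: ler_pM.
- by rewrite addr_ge0 // ?mulr_ge0 ?sumr_ge0 // ?invr_ge0 // => *; rewrite ?mulr_ge0 ?invr_ge0 //.
- by rewrite sumr_ge0 // => l _; rewrite invr_ge0.
- have h := sum_inv_sqr z.
  rewrite expn0 expn1 invr1 mul1r.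
  have r2 : r%:R^-1 <= 1 :> R by rewrite invf_le1 ?ltr0n // ler1n.
  have r0 : 0 <= r%:R^-1 :> R by rewrite invr_ge0.
  have h0 : 0 <= \sum_(1 <= m < z.+1) (m ^ 2)%:R^-1 :> R by rewrite sumr_ge0 // => *;
    rewrite invr_ge0.
  nra.
rewrite /G big_seq [leRHS]big_seq; apply: ler_sum => l;
  rewrite mem_sieve_support => /and4P[l_gt0 _ _ _].
rewrite lef_pV2 ?posrE ?ltr0n ?totient_gt0 // ler_nat totient_count_coprime.
apply: (@leq_trans (\sum_(0 <= d < l) 1)%N); last by rewrite sum_nat_const_nat subn0 muln1.
by apply: leq_sum => d _; case: coprime.
Qed.

End SelbergSieve.

(** * The sieve bound on dyadic blocks *)

Section DyadicSieve.
Variable R : realType.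
Let W (p : nat) : R := ln p%:R / p%:R.

(** Sieve with z = 2^i, i = floor(j/16), each ln p / p being at most (j + 1) / 2^j. Since G >= i /
    8, the main term is at most 256 / r. The remainder is at most 1 / r because r <= j^2 and 7 i +
    12 <= 16 i <= j. *)
Lemma sieve_dyadic_block j r : prime r -> (32 <= j)%N -> (r <= j ^ 2)%N ->
  \sum_((2 ^ j).+1 <= p < (2 ^ j.+1).+1 | prime p && (r %| p.+1)%N) W p <= 257 / r%:R.
Proof.
move=> r_pr j_ge r_j; set i := (j %/ 16)%N; pose z := (2 ^ i)%N.
have r_gt0 := prime_gt0 r_pr.
have i_ge2 : (2 <= i)%N by rewrite /i leq_divRL.
have j_i : (j.+1 <= 16 * i.+1)%N by rewrite mulnC; exact: ltn_ceil.
have i_j : (16 * i <= j)%N by rewrite mulnC; exact: leq_trunc_div.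
have z_gt0 : (0 < z)%N by rewrite expn_gt0.
have z_lt : (z < (2 ^ j).+1)%N by rewrite ltnS leq_exp2l //; lia.
have G_gt0 := sieve_mass_gt0 R r z_gt0.
have G_lb := sieve_mass_lb R r_pr z_gt0; set G := sieve_mass R r z in G_gt0 G_lb.
have pj0 : 0 < (2 ^ j)%:R :> R by rewrite ltr0n expn_gt0.
have r0 : 0 < r%:R :> R by rewrite ltr0n.
have i0 : 2 <= i%:R :> R by rewrite ler_nat.
have := selberg_upper_bound R r_pr z_gt0 (2 ^ j) z_lt.
rewrite addSn addnn -mul2n -expnS -/G => count_le.
apply: (@le_trans _ _ (j.+1%:R / (2 ^ j)%:R * ((2 ^ j)%:R / r%:R / G + (z ^ 4)%:R))).
  apply: (le_trans _ (ler_wpM2l _ count_le)); last by rewrite divr_ge0.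
  rewrite mulr_sumr big_mkcond big_seq [leRHS]big_seq; apply: ler_sum => p.
  rewrite mem_index_iota => /andP[p_lb p_ub].
  case: ifP => [/andP[p_pr r_p]|_]; last by rewrite mulr_ge0 // divr_ge0.
  rewrite mulr1; apply: ler_pM; [exact: ln_nat_ge0 | by rewrite invr_ge0 | | ].
    apply: (@le_trans _ _ (ln (2 ^ j.+1)%:R)); first by rewrite ler_ln_nat // prime_gt0.
    by rewrite ln_pow2 ler_piMr // ln2_le1.
  have p0 : 0 < p%:R :> R by rewrite ltr0n prime_gt0.
  by rewrite lef_pV2 ?posrE // ler_nat ltnW.
have part1 : j.+1%:R / (2 ^ j)%:R * ((2 ^ j)%:R / r%:R / G) <= 256 / r%:R.
  have -> : j.+1%:R / (2 ^ j)%:R * ((2 ^ j)%:R / r%:R / G) = j.+1%:R / G / r%:R.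
    by move: (j.+1%:R : R) => y; field; rewrite !lt0r_neq0.
  rewrite ler_pM2r ?invr_gt0 // ler_pdivrMr //.
  have lnz : i%:R * 2^-1 <= 4 * G.
    by apply: le_trans G_lb; rewrite ln_pow2 ler_wpM2l // ln2_ge_half.
  have : j.+1%:R <= 16 * (i%:R + 1) :> R by rewrite natr1 -natrM ler_nat.
  lra.
have part2 : j.+1%:R / (2 ^ j)%:R * (z ^ 4)%:R <= 1 / r%:R :> R.
  rewrite mulrAC ler_pdivrMr // mul1r [leRHS]mulrC ler_pdivlMr // -!natrM ler_nat.
  apply: (@leq_trans (2 ^ (4 * i) * (16 * i.+1) ^ 3)%N).
    have -> : (z ^ 4 = 2 ^ (4 * i))%N by rewrite /z -expnM mulnC.
    rewrite [(j.+1 * _)%N]mulnC -mulnA leq_mul2l; apply/orP; right.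
    rewrite [(_ ^ 3)%N]expnS leq_mul // (leq_trans r_j) // leq_sqr; exact: ltnW.
  apply: (@leq_trans (2 ^ (4 * i) * (2 ^ 12 * 2 ^ (i * 3)))%N).
    rewrite leq_mul2l expnMn; apply/orP; right; rewrite (expnM 2 i 3).
    by apply: leq_mul => //; rewrite leq_exp2r // ltn_expl.
  by rewrite -!expnD leq_exp2l //; clear -i_ge2 i_j; lia.
rewrite mulrDr; apply: le_trans (lerD part1 part2) _.
by rewrite -mulrDl natr1.
Qed.

Lemma sieve_dyadic_range J r : prime r -> (32 <= J)%N -> (r <= J ^ 2)%N ->
  \sum_((2 ^ J).+1 <= p < (2 ^ (J + J)).+1 | prime p && (r %| p.+1)%N) W p <= J%:R * (257 / r%:R).
Proof.
move=> r_pr J_ge r_J; suff h k :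
  \sum_((2 ^ J).+1 <= p < (2 ^ (J + k)).+1 | prime p && (r %| p.+1)%N) W p <= k%:R * (257 / r%:R).
  exact: h.
elim: k => [|k IH]; first by rewrite addn0 big_geq // mul0r.
rewrite (big_cat_nat _ (n := (2 ^ (J + k)).+1)) ?ltnS ?leq_exp2l ?leq_addr ?addnS //.
rewrite -natr1 mulrDl mul1r; apply: lerD => //; apply: sieve_dyadic_block => //.
  by rewrite (leq_trans J_ge) // leq_addr.
by rewrite (leq_trans r_J) // leq_sqr leq_addr.
Qed.

End DyadicSieve.

(** * Prime divisors of an integer and the product for the totient *)

Lemma size_primes_le n : (0 < n)%N -> (2 ^ size (primes n) <= n)%N.
Proof.
move: n; apply: pfactor_ind => // p e n p_pr e_gt0 n_gt0 p_n IH.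
have co : coprime (p ^ e) n by rewrite coprimeXl // prime_coprime.
rewrite (perm_size (perm_primesM _ n_gt0 co)) ?expn_gt0 ?(prime_gt0 p_pr) //.
rewrite primesX // primes_prime //= expnS; apply: leq_mul => //.
by apply: leq_trans (prime_gt1 p_pr) _; rewrite -{1}(expn1 p) leq_pexp2l // prime_gt0.
Qed.

Lemma totient_prod_primes (R : realType) n : (0 < n)%N ->
  (totient n)%:R / n%:R = \prod_(q <- primes n) (1 - q%:R^-1) :> R.
Proof.
move: n; apply: pfactor_ind => [|p e n p_pr e_gt0 n_gt0 p_n IH].
  by rewrite big_nil divr1.
have co : coprime (p ^ e) n by rewrite coprimeXl // prime_coprime.
have p_gt0 := prime_gt0 p_pr.
have p0 : p%:R != 0 :> R by rewrite pnatr_eq0 -lt0n.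
have n0 : n%:R != 0 :> R by rewrite pnatr_eq0 -lt0n.
have pe_gt0 : (0 < p ^ e)%N by rewrite expn_gt0 p_gt0.
rewrite (perm_big _ (perm_primesM pe_gt0 n_gt0 co)) primesX // primes_prime //= big_cons -IH.
rewrite totient_coprime // totient_pfactor // -(prednK e_gt0) /= expnS !natrM natrX.
rewrite -subn1 natrB //; field; by rewrite p0 n0 expf_neq0.
Qed.

Lemma sum_inv_pronic (R : realType) a b : (0 < a)%N ->
  \sum_(a.+1 <= q < b.+1) (q%:R * (q%:R - 1))^-1 <= a%:R^-1 :> R.
Proof.
move=> a_gt0; case: (leqP b a) => [b_a|a_b]; first by rewrite big_geq // invr_ge0.
suff h k : \sum_(a.+1 <= q < (a + k).+1) (q%:R * (q%:R - 1))^-1 <= a%:R^-1 - (a + k)%:R^-1 :> R.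
  by rewrite -(subnKC (ltnW a_b)) (le_trans (h _)) // gerBl invr_ge0.
elim: k => [|k IH]; first by rewrite addn0 big_geq // subrr.
rewrite addnS big_nat_recr /=; last by rewrite ltnS leq_addr.
apply: le_trans (lerD IH (lexx _)) _; rewrite -natr1.
have : 1 <= (a + k)%:R :> R by rewrite ler1n addn_gt0 a_gt0.
set x := (a + k)%:R => x1; rewrite le_eqVlt; apply/orP; left; apply/eqP.
move: (a%:R^-1 : R) => y.
by field; rewrite !lt0r_neq0 //; lra.
Qed.

(** * Shifted primes with few prime divisors *)

Section ShiftedPrimes.
Variable R : realType.
Let W (p : nat) : R := ln p%:R / p%:R.
Local Notation dyadic J := (index_iota (2 ^ J).+1 (2 ^ (J + J)).+1).

Let W_ge0 p : 0 <= W p.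
Proof. by rewrite divr_ge0 ?ln_nat_ge0. Qed.

Lemma dirichlet_dyadic m a : (1 < m)%N -> coprime m a -> exists2 C : R, 0 <= C & forall J,
  `|\sum_(p <- dyadic J | prime p && (p == a %[mod m])) W p
     - J%:R * ln 2 / (totient m)%:R| <= C.
Proof.
move=> m_gt1 co_ma; have [C CP] := dirichlet R m_gt1 co_ma.
have pow_gt0 k : (0 < 2 ^ k)%N by rewrite expn_gt0.
exists (C + C) => [|J].
  by rewrite addr_ge0 // (le_trans _ (CP 1%N isT)).
have := CP _ (pow_gt0 J); have := CP _ (pow_gt0 (J + J)%N).
rewrite !ln_pow2 (big_cat_nat _ (n := (2 ^ J).+1)) //=; last first.
  by rewrite ltnS leq_exp2l // leq_addr.
set S1 := \sum_(1 <= _ < _ | _) _; set S2 := \sum_(_ <- _ | _) _.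
rewrite natrD !mulrDl; set A := J%:R * ln 2 / _.
by rewrite !ler_norml => /andP[h1 h2] /andP[h3 h4]; apply/andP; split; lra.
Qed.

Lemma residue_and_divisor M a q : prime q -> coprime M q -> coprime M a ->
  exists2 b, coprime (M * q) b &
    forall p, (p == a %[mod M]) && (q %| p.+1)%N = (p == b %[mod M * q]).
Proof.
move=> q_pr M_q M_a; have q_gt0 := prime_gt0 q_pr.
exists (chinese M q a q.-1).
  rewrite coprimeMl -coprime_modr chinese_modl // coprime_modr M_a /=.
  rewrite -coprime_modr chinese_modr // coprime_modr -{1}(prednK q_gt0) coprimeSn //.
move=> p; rewrite chinese_remainder // chinese_modl // chinese_modr //; congr (_ && _).
by rewrite -(eqn_modDr 1) !addn1 prednK // modnn.
Qed.

Lemma exchange_prime_divisors u v (s : seq nat) (P : pred nat) :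
  \sum_(p <- s | P p) W p * \sum_(u <= q < v | prime q && (q %| p.+1)%N) (q%:R^-1 : R) =
  \sum_(u <= q < v | prime q) q%:R^-1 * \sum_(p <- s | P p && (q %| p.+1)%N) W p.
Proof.
under eq_bigr do rewrite mulr_sumr.
rewrite (exchange_big_dep prime) /=; last by move=> p q _ /andP[].
apply: eq_bigr => q q_pr; rewrite mulr_sumr; apply: eq_big => [p|p _]; first by rewrite q_pr.
by rewrite mulrC.
Qed.

Lemma big_primes_interval (T : Type) (idx : T) (op : Monoid.com_law idx) u v n (F : nat -> T) :
  (0 < n)%N ->
  \big[op/idx]_(q <- primes n | (u <= q < v)%N) F q =
  \big[op/idx]_(u <= q < v | prime q && (q %| n)%N) F q.
Proof.
move=> n_gt0; rewrite -big_filter -[RHS]big_filter; apply: perm_big.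
apply: uniq_perm; rewrite ?filter_uniq ?primes_uniq ?iota_uniq // => q.
by rewrite !mem_filter mem_primes mem_index_iota n_gt0 andbC.
Qed.

(** The conditions on q stand behind the existential so that constants can be chosen for all q at
    once. *)
Lemma dirichlet_divisor_dyadic M a q : (1 < M)%N -> coprime M a ->
  exists2 C : R, 0 <= C & prime q -> coprime M q -> forall J,
  \sum_(p <- dyadic J | prime p && (p == a %[mod M]) && (q %| p.+1)%N) W p <=
    J%:R * ln 2 / (totient M)%:R / (q%:R - 1) + C.
Proof.
move=> M_gt1 M_a; have [q_pr|] := boolP (prime q); last by exists 0.
have [M_q|] := boolP (coprime M q); last by exists 0.
have [b b_co bP] := residue_and_divisor q_pr M_q M_a.
have Mq_gt1 : (1 < M * q)%N by rewrite (leq_trans M_gt1) // leq_pmulr // prime_gt0.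
have [C C_ge0 CP] := dirichlet_dyadic Mq_gt1 b_co.
exists C => // _ _ J; rewrite -lerBlDl; apply: le_trans (CP J).
apply: le_trans (ler_norm _); rewrite lerD //.
  by rewrite (eq_bigl (fun p => prime p && (p == b %[mod M * q]))) // => p; rewrite -andbA bP.
rewrite totient_coprime // (totient_prime q_pr) natrM invfM mulrA -subn1 natrB ?prime_gt0 //.
Qed.

(** n + 1 has at most 2 J prime divisors, and each one counted here contributes less than 1 /
    J^2. *)
Lemma sum_large_primes n J : (0 < n <= 2 ^ (J + J))%N -> (0 < J)%N ->
  \sum_(q <- primes n.+1 | ((J ^ 2) < q)%N) (q%:R^-1 : R) <= 2 / J%:R.
Proof.
move=> /andP[n_gt0 n_J] J_gt0; have J0 : 0 < J%:R :> R by rewrite ltr0n.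
have size_le : (size (primes n.+1) <= J + J)%N.
  rewrite -ltnS -(ltn_exp2l _ _ (ltnSn 1)) (leq_ltn_trans (size_primes_le _)) //.
  apply: (@leq_ltn_trans (2 ^ (J + J)).+1) => //.
  by rewrite expnS mul2n -addnn -addn1 ltn_add2l -{1}(expn0 2) ltn_exp2l // addn_gt0 J_gt0.
apply: (@le_trans _ _ (\sum_(q <- primes n.+1) (J ^ 2)%:R^-1)).
  rewrite big_mkcond; apply: ler_sum => q _; case: ifP => [q_J|_]; last by rewrite invr_ge0.
  by rewrite lef_pV2 ?posrE ?ltr0n ?expn_gt0 ?J_gt0 ?(leq_trans _ q_J) // ler_nat ltnW.
rewrite big_const_seq count_predT iter_addr_0 -[_ *+ size _]mulr_natl natrX.
rewrite (_ : 2 / J%:R = (J + J)%:R / J%:R ^+ 2); last first.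
  by rewrite natrD; field; rewrite lt0r_neq0.
by rewrite ler_pM2r ?invr_gt0 ?exprn_gt0 // ler_nat.
Qed.

(** Were the sum at least eps for all primes of the class in (2^J, 4^J], its weighted total would
    exceed the bound found by exchanging the sums over p and q. *)
Lemma exists_shifted_prime M a y (eps : R) B : (1 < M)%N -> coprime M a -> (0 < y)%N ->
  (forall q, prime q -> (y < q)%N -> coprime M q) -> 0 < eps -> y%:R^-1 <= eps / 4 ->
  exists p, [/\ prime p, (B < p)%N, p = a %[mod M] &
    \sum_(q <- primes p.+1 | (y < q)%N) q%:R^-1 < eps].
Proof.
move=> M_gt1 M_a y_gt0 My eps_gt0 y_eps.
have big_index b c d : exists J, [/\ b < J, c <= J, 32 <= J & d <= J]%N.
  by clear; exists (b + c + 32 + d).+1; split; lia.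
have [C C_ge0 CP] := dirichlet_dyadic M_gt1 M_a.
pose bnd q (c : R) := 0 <= c /\ (prime q -> coprime M q -> forall J,
   \sum_(p <- dyadic J | prime p && (p == a %[mod M]) && (q %| p.+1)%N) W p <=
    J%:R * ln 2 / (totient M)%:R / (q%:R - 1) + c).
have [|Cq CqP] := @choice nat R bnd.
  by move=> q; have [c c_ge0 cP] := dirichlet_divisor_dyadic q M_gt1 M_a; exists c.
pose t : R := ln 2 / (totient M)%:R.
have phi_ge1 : 1 <= (totient M)%:R :> R by rewrite ler1n totient_gt0 ltnW.
have t_gt0 : 0 < t by rewrite divr_gt0 ?ln_gt0 //; lra.
have t_le1 : t <= 1.
  by rewrite ler_pdivrMr ?mul1r ?(le_trans (ln2_le1 R)) //; lra.
have arch (x : R) : exists n : nat, x <= n%:R.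
  by exists (Num.trunc x).+1; exact: ltW (truncnS_gt _).
(* For q > N1 the congruence modulo M is given up when sieving; N1 is large enough to absorb the
   lost factor phi(M) hidden in t. *)
have [N0 N0P] := arch (257 / (eps * t / 4)).
pose N1 := (N0 + y)%N.
have et_gt0 : 0 < eps * t by rewrite mulr_gt0.
have N1_ge : 257 / N1%:R <= eps * t / 4.
  rewrite ler_pdivrMr ?ltr0n ?addn_gt0 ?y_gt0 ?orbT // mulrC -ler_pdivrMr; last by lra.
  by apply: (le_trans N0P); rewrite ler_nat leq_addr.
pose K := \sum_(y.+1 <= q < N1.+1) Cq q.
have K_ge0 : 0 <= K by rewrite sumr_ge0 // => q _; case: (CqP q).
(* The constants [Cq q] are uncontrolled in q, but only those with y < q <= N1 enter K, which is
   fixed before J is chosen. *)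
have [J0 J0P] := arch ((eps * C + K + 2 + 2 * C) / (eps * t / 2)).
have [J [J0_J N1_J J_ge32 B_J]] : exists J, [/\ J0 < J, N1 <= J, 32 <= J & B <= J]%N.
  exact: big_index.
have J_gt0' : (0 < J)%N by apply: leq_trans J_ge32.
have J_gt0 : 0 < J%:R :> R by rewrite ltr0n.
pose P p := prime p && (p == a %[mod M]).
pose f p : R := \sum_(q <- primes p.+1 | (y < q)%N) q%:R^-1.
have [/hasP[p p_J /and3P[p_pr p_a fp]]|none] :=
    boolP (has (fun p => [&& prime p, p == a %[mod M] & f p < eps]) (dyadic J)).
  exists p; split => //; last exact/eqP.
  move: p_J; rewrite mem_index_iota => /andP[p_J _].
  by apply: leq_ltn_trans p_J; rewrite (leq_trans B_J) // ltnW // ltn_expl.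
exfalso; set T := \sum_(p <- dyadic J | P p) W p.
have T_bd : `|T - J%:R * t| <= C by have := CP J; rewrite -mulrA.
have lower : eps * T <= \sum_(p <- dyadic J | P p) W p * f p.
  rewrite mulr_sumr big_seq_cond [leRHS]big_seq_cond;
    apply: ler_sum => p /andP[p_J /andP[p_pr p_a]].
  rewrite mulrC ler_wpM2l // leNgt; apply: contra none => fp.
  by apply/hasP; exists p => //; apply/and3P.
have fE p : f p = \sum_(y.+1 <= q < N1.+1 | prime q && (q %| p.+1)%N) q%:R^-1 +
    \sum_(N1.+1 <= q < (J ^ 2).+1 | prime q && (q %| p.+1)%N) q%:R^-1 +
    \sum_(q <- primes p.+1 | ((J ^ 2) < q)%N) q%:R^-1.
  have yN1 : (y.+1 <= N1.+1)%N by rewrite ltnS leq_addl.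
  have N1J : (N1.+1 <= (J ^ 2).+1)%N.
    by rewrite ltnS (leq_trans N1_J) // -{1}(expn1 J) leq_pexp2l.
  rewrite -big_cat_nat // -big_primes_interval //= /f (bigID (fun q => (q < (J ^ 2).+1)%N)) /=.
  congr (_ + _); apply: eq_bigl => q; rewrite -leqNgt.
  by apply/andP/idP => [[]//|Jq]; split => //; apply: leq_ltn_trans Jq;
    rewrite -ltnS (leq_trans yN1).
have part1 : \sum_(p <- dyadic J | P p) W p *
    \sum_(y.+1 <= q < N1.+1 | prime q && (q %| p.+1)%N) q%:R^-1 <= J%:R * t / y%:R + K.
  rewrite exchange_prime_divisors big_mkcond.
  apply: (@le_trans _ _ (\sum_(y.+1 <= q < N1.+1) (J%:R * t * (q%:R * (q%:R - 1))^-1 + Cq q))).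
    rewrite big_seq [leRHS]big_seq; apply: ler_sum => q; rewrite mem_index_iota => /andP[y_q _].
    have [Cq_ge0 CqJ] := CqP q.
    have q_ge2 : 2 <= q%:R :> R by rewrite ler_nat (leq_trans _ y_q).
    have Jt_ge0 : 0 <= J%:R * t by rewrite mulr_ge0 // ltW.
    have q_gt0 : 0 < q%:R :> R by apply: lt_le_trans q_ge2.
    have q_ge1 : 1 <= q%:R :> R by apply: le_trans q_ge2; rewrite ler1n.
    have q1_ge0 : 0 <= q%:R - 1 :> R by rewrite subr_ge0.
    case: ifP => q_pr; last by rewrite addr_ge0 // mulr_ge0 // invr_ge0 mulr_ge0.
    have q_le1 : q%:R^-1 <= 1 :> R by rewrite invf_le1.
    have q_ge0 : 0 <= q%:R^-1 :> R by rewrite invr_ge0.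
    apply: (le_trans (ler_wpM2l q_ge0 (CqJ q_pr (My q q_pr y_q) J))).
    rewrite mulrDr lerD //; last by rewrite ler_piMl.
    by rewrite -(mulrA J%:R) -/t invfM mulrCA mulrA.
  rewrite big_split /= lerD // -mulr_sumr ler_wpM2l ?sum_inv_pronic // mulr_ge0 // ltW //.
have part2 : \sum_(p <- dyadic J | P p) W p *
    \sum_(N1.+1 <= q < (J ^ 2).+1 | prime q && (q %| p.+1)%N) q%:R^-1 <= J%:R * (eps * t / 4).
  rewrite exchange_prime_divisors big_mkcond.
  apply: (@le_trans _ _ (\sum_(N1.+1 <= q < (J ^ 2).+1) (J%:R * 257 * (q%:R * (q%:R - 1))^-1))).
    rewrite big_seq [leRHS]big_seq; apply: ler_sum => q; rewrite mem_index_iota => /andP[N_q q_J].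
    have q_ge2 : 2 <= q%:R :> R by rewrite ler_nat (leq_trans _ N_q) // !ltnS /N1 addn_gt0
      y_gt0 orbT.
    have q_gt0 : 0 < q%:R :> R by apply: lt_le_trans q_ge2.
    have q1_gt0 : 0 < q%:R - 1 :> R by rewrite subr_gt0 (lt_le_trans _ q_ge2) // ltr1n.
    have q1_ge0 := ltW q1_gt0.
    case: ifP => q_pr; last by rewrite mulr_ge0 ?mulr_ge0 // invr_ge0 mulr_ge0.
    have q_ge0 : 0 <= q%:R^-1 :> R by rewrite invr_ge0.
    apply: (@le_trans _ _ (q%:R^-1 * (J%:R * (257 / q%:R)))).
      rewrite ler_wpM2l //.
      apply: le_trans (sieve_dyadic_range R q_pr J_ge32 q_J).
      rewrite [leRHS](bigID (fun p => p == a %[mod M])) /=.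
      rewrite (eq_bigl (fun p => prime p && (q %| p.+1)%N && (p == a %[mod M]))); last first.
        by move=> p; rewrite /P -!andbA; congr (_ && _); rewrite andbC.
      by rewrite lerDl; apply: sumr_ge0 => p _; exact: W_ge0.
    have -> : q%:R^-1 * (J%:R * (257 / q%:R)) = J%:R * 257 * (q%:R * q%:R)^-1 :> R.
      by move: (J%:R : R) => x; field; rewrite lt0r_neq0.
    rewrite ler_wpM2l ?mulr_ge0 // lef_pV2 ?posrE ?mulr_gt0 //.
    by rewrite ler_pM2l // gerBl.
  rewrite -mulr_sumr -mulrA ler_wpM2l // (le_trans _ N1_ge) // ler_wpM2l // sum_inv_pronic //.
  by rewrite addn_gt0 y_gt0 orbT.
have part3 : \sum_(p <- dyadic J | P p) W p *
    \sum_(q <- primes p.+1 | ((J ^ 2) < q)%N) q%:R^-1 <= 2 / J%:R * T.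
  rewrite mulr_sumr big_seq_cond [leRHS]big_seq_cond; apply: ler_sum => p.
  rewrite mem_index_iota => /andP[/andP[J_p p_J] _]; rewrite [leRHS]mulrC ler_wpM2l //.
  by apply: sum_large_primes => //; rewrite (leq_ltn_trans (leq0n _) J_p) /= -ltnS.
have upper : eps * T <= J%:R * t / y%:R + K + J%:R * (eps * t / 4) + 2 / J%:R * T.
  apply: (le_trans lower); under eq_bigr do rewrite fE !mulrDr.
  by rewrite !big_split /= !lerD.
(* The total is at least eps (J t - C), while the first two ranges of q take at most half of eps J
   t, up to K, and the last at most 2 + 2 C. *)
have J_big : eps * C + K + 2 + 2 * C < J%:R * (eps * t / 2).
  rewrite -ltr_pdivrMr; last by lra.
  by apply: (le_lt_trans J0P); rewrite ltr_nat.
have h3 : 2 / J%:R * T <= 2 + 2 * C.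
  rewrite mulrAC ler_pdivrMr //.
  have : 1 <= J%:R :> R by rewrite ler1n.
  move: T_bd; rewrite ler_norml => /andP[_]; nra.
have h1 : J%:R * t / y%:R <= J%:R * (eps * t / 4).
  rewrite -mulrA ler_wpM2l ?(ltW J_gt0) //.
  have := ler_wpM2l (ltW t_gt0) y_eps; lra.
have h0 : eps * (J%:R * t - C) <= eps * T.
  rewrite ler_pM2l //; move: T_bd; rewrite ler_norml => /andP[]; lra.
move: upper J_big h0 h1 h3; rewrite mulrBr; nra.
Qed.

End ShiftedPrimes.

(** * Density *)

Section Density.
Variable R : realType.

(** Each range (2^J, 4^J] with J >= 4 C yields another 1/4: the sum of ln p / p is at least J ln 2 -
    C there, and ln p <= 2 J ln 2. *)
Lemma sum_inv_primes_unbounded y k : exists2 Z, (y <= Z)%N &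
  k%:R / 4 <= \sum_(y.+1 <= p < Z.+1 | prime p) p%:R^-1 :> R.
Proof.
elim: k => [|k [Z y_Z IH]]; first by exists y; rewrite // mul0r big_geq.
have [C C_ge0 CP] := @dirichlet_dyadic R 2 1 isT isT.
have ln2 := ln2_ge_half R.
pose J := (Num.trunc (4 * C) + Z).+1.
have J_C : 4 * C <= J%:R.
  by apply: ltW; apply: lt_le_trans (truncnS_gt _) _; rewrite ler_nat ltnS leq_addr.
have Z_J : (Z <= 2 ^ J)%N by rewrite ltnW // (leq_trans _ (ltnW (ltn_expl _ _))) // ltnS leq_addl.
have J_gt0 : 0 < J%:R :> R by rewrite ltr0n.
move: J_C Z_J J_gt0; move: {J}(J) => J J_C Z_J J_gt0.
have Jl_gt0 : 0 < (J + J)%:R * ln 2 :> R.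
  by rewrite natrD mulr_gt0 ?addr_gt0 // (lt_le_trans _ ln2) // invr_gt0.
exists (2 ^ (J + J))%N; first by rewrite (leq_trans y_Z) // (leq_trans Z_J) // leq_exp2l //
  leq_addr.
have inv_ge0 p : 0 <= p%:R^-1 :> R by rewrite invr_ge0.
have J_JJ : (2 ^ J <= 2 ^ (J + J))%N by rewrite leq_exp2l // leq_addr.
rewrite (big_cat_nat _ (n := Z.+1)) ?ltnS ?(leq_trans Z_J) //=.
rewrite -natr1 mulrDl; apply: lerD => //.
rewrite (big_cat_nat _ (n := (2 ^ J).+1)) ?ltnS //=.
apply: (@le_trans _ _ (\sum_((2 ^ J).+1 <= p < (2 ^ (J + J)).+1 | prime p) p%:R^-1)); last first.
  by rewrite lerDr sumr_ge0.
rewrite mul1r; have := CP J; rewrite ler_norml => /andP[lower _].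
rewrite -(ler_pM2r Jl_gt0).
apply: (@le_trans _ _ (\sum_((2 ^ J).+1
  <= p < (2 ^ (J + J)).+1 | prime p && (p == 1 %[mod 2])) ln p%:R / p%:R)).
  move: lower; rewrite (_ : totient 2 = 1%N) // divr1; set S := \sum_(_ <= _ < _ | _) _ => lower.
  by move: lower J_C; rewrite natrD; nra.
rewrite mulr_suml big_mkcondr /= big_seq_cond [leRHS]big_seq_cond; apply: ler_sum => p.
rewrite mem_index_iota => /andP[/andP[p_lb p_ub] p_pr].
case: ifP => _; last by rewrite mulr_ge0 // ltW.
rewrite mulrC ler_wpM2l // -ln_pow2 ler_ln_nat ?prime_gt0 //.
Qed.

(** The prime 2 is always selected, since p + 1 is even for odd p. *)
Definition selected_product y0 j : R :=
  \prod_(1 <= q < j.+1 | prime q && ((q == 2%N) || (y0 < q)%N)) (1 - q%:R^-1).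

Lemma inv_prime_bounds q : prime q -> 0 <= (q%:R^-1 : R) <= 1.
Proof. by move=> q_pr; rewrite invr_ge0 ler0n invf_le1 ?ltr0n ?ler1n prime_gt0. Qed.

Lemma selected_product_bounds y0 j : 0 <= selected_product y0 j <= 1.
Proof.
apply/andP; split; [apply: prodr_ge0 | apply: prodr_ile1];
  move=> q /andP[/inv_prime_bounds/andP[h1 h2] _]; by rewrite subr_ge0 h2 ?gerBl.
Qed.

Lemma selected_product_base y0 : (1 < y0)%N -> selected_product y0 y0 = 2^-1.
Proof.
move=> y0_gt1; rewrite /selected_product -big_filter (bigD1_seq 2%N) /=; first last.
- by rewrite filter_uniq ?iota_uniq.
- by rewrite mem_filter mem_index_iota /= ltnS.
rewrite big1_seq ?mulr1; first by field.
move=> q /andP[q_neq2]; rewrite mem_filter mem_index_iota (negPf q_neq2) /= ltnS.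
by rewrite ltnNge => /andP[/andP[_ /negPf h]]; rewrite h andbF.
Qed.

Lemma selected_productS y0 j : (1 < y0)%N -> (y0 <= j)%N ->
  selected_product y0 j.+1 =
  selected_product y0 j * (if prime j.+1 then 1 - j.+1%:R^-1 else 1).
Proof.
move=> y0_gt1 y0_j; rewrite /selected_product big_mkcond big_nat_recr //= -big_mkcond.
by rewrite ltnS y0_j orbT andbT.
Qed.

(** A new prime with reciprocal a preserves the bound, as (1 - a) (1 + s + a) <= 1 + s. With the
    divergence of the sum of 1/p this drives the product to 0. *)
Lemma selected_product_small y0 j : (1 < y0)%N -> (y0 <= j)%N ->
  selected_product y0 j * (1 + \sum_(y0.+1 <= p < j.+1 | prime p) p%:R^-1) <= 1.
Proof.
move=> y0_gt1 y0_j; rewrite -(subnKC y0_j); elim: (j - y0)%N => [|k IH].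
  rewrite addn0 big_geq // addr0 mulr1; by case/andP: (selected_product_bounds y0 y0).
rewrite addnS selected_productS ?leq_addr // big_mkcond big_nat_recr /=;
  last by rewrite ltnS leq_addr.
rewrite -big_mkcond /=; case: ifP => [p_pr|_]; last by rewrite mulr1 addr0.
apply: le_trans IH; rewrite -mulrA; have /andP[P0 _] := selected_product_bounds y0 (y0 + k).
apply: ler_wpM2l => //; set s := \sum_(_ <= _ < _ | _) _.
have s_ge0 : 0 <= s by rewrite sumr_ge0 // => q _; rewrite invr_ge0.
have /andP[a0 a1] := inv_prime_bounds p_pr; move: a0 a1; set a := _^-1 => a0 a1; nra.
Qed.

(* Starting from 1/2, each factor changes the product by at most 1 / y0 and
   the product tends to 0, so it comes within 1 / y0 of any point of [0, 1/2]. *)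
Lemma selected_product_dense (x dl : R) : 0 <= x -> x <= 2^-1 -> 0 < dl ->
  exists y0 j, [/\ (1 < y0)%N, (y0 <= j)%N & `|selected_product y0 j - x| <= dl].
Proof.
move=> x_ge0 x_le dl_gt0.
pose y0 := (Num.trunc dl^-1).+2; have y0_gt1 : (1 < y0)%N by [].
have y0_dl : y0%:R^-1 <= dl.
  rewrite invf_ple ?posrE ?ltr0n // ltW // (lt_trans (truncnS_gt _)) // ltr_nat //.
move: y0_gt1 y0_dl; move: {y0}(y0) => y0 y0_gt1 y0_dl.
pose near j := (y0 <= j)%N && (selected_product y0 j < x + dl).
have near_ex : exists j, near j.
  pose k := (Num.trunc (4 / dl)).+1.
  have [Z y_Z sumZ] := sum_inv_primes_unbounded y0 k.
  exists Z; rewrite /near y_Z /=; have := selected_product_small y0_gt1 y_Z.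
  have kd : 4 / dl < k%:R by exact: truncnS_gt.
  set s := \sum_(_ <= _ < _ | _) _ in sumZ *; set P := selected_product y0 Z => Ps.
  have s_dl : 1 < s * dl.
    rewrite -ltr_pdivrMr // div1r; move: kd; rewrite mulrC => kd.
    have : dl^-1 * 4 < k%:R by []. 
    lra.
  have /andP[P0 _] := selected_product_bounds y0 Z; rewrite -/P in P0.
  rewrite ltNge; apply/negP => P_ge; nra.
have [j /andP[y0_j Pj] j_min] := ex_minnP near_ex.
exists y0, j; split => //; rewrite ler_norml; apply/andP; split; last by lra.
move: y0_j; rewrite leq_eqVlt => /orP[/eqP <-|y0_j].
  by rewrite selected_product_base //; lra.
case: j y0_j Pj j_min => // j y0_j Pj j_min.
have Pj_ge : x + dl <= selected_product y0 j.
  rewrite leNgt; apply/negP => h; have := j_min j; rewrite /near -ltnS y0_j h => /(_ isT).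
  by rewrite ltnn.
rewrite selected_productS //; have /andP[P0 P1] := selected_product_bounds y0 j.
case: ifP => [p_pr|_]; last by lra.
have : j.+1%:R^-1 <= dl.
  by apply: le_trans y0_dl; rewrite lef_pV2 ?posrE ?ltr0n ?(ltnW y0_gt1) // ler_nat ltnW.
have /andP[a0 a1] := inv_prime_bounds p_pr; move: a0 a1; set a := _^-1 => a0 a1 a_dl; nra.
Qed.

(** Weierstrass's product inequality. *)
Lemma prod_one_sub_ge (s : seq nat) (P : pred nat) (F : nat -> R) :
  (forall q, q \in s -> P q -> 0 <= F q <= 1) ->
  1 - \sum_(q <- s | P q) F q <= \prod_(q <- s | P q) (1 - F q) <= 1.
Proof.
elim: s => [|q s IH] F01; first by rewrite !big_nil subr0 lexx.
have F01s q' : q' \in s -> P q' -> 0 <= F q' <= 1.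
  by move=> q's; apply: F01; rewrite inE q's orbT.
have /andP[h1 h2] := IH F01s.
rewrite !big_cons; case: ifP => Pq; last by rewrite h1.
have /andP[F0 F1] := F01 q (mem_head _ _) Pq.
have S_ge0 : 0 <= \sum_(q <- s | P q) F q.
  rewrite big_seq_cond sumr_ge0 // => q' /andP[q's Pq'].
  by case/andP: (F01s q' q's Pq').
have P_ge0 : 0 <= \prod_(q <- s | P q) (1 - F q).
  rewrite big_seq_cond prodr_ge0 // => q' /andP[q's Pq'].
  by case/andP: (F01s q' q's Pq'); rewrite subr_ge0.
by apply/andP; split; nra.
Qed.

(** * Prescribing the small prime divisors of p + 1 *)

Lemma coprime_prod_primes y (P Q : pred nat) : (forall q, P q -> ~~ Q q) ->
  coprime (\prod_(1 <= q < y.+1 | prime q && P q) q) (\prod_(1 <= q < y.+1 | prime q && Q q) q).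
Proof.
move=> PQ.
apply: (big_ind (fun n => coprime n _)) => [|m n m_co n_co|q /andP[q_pr Pq]].
- by rewrite coprime1n.
- by rewrite coprimeMl m_co.
apply: (big_ind (fun n => coprime q n)) => [|m n m_co n_co|q' /andP[q'_pr Qq']].
- by rewrite coprimen1.
- by rewrite coprimeMr m_co.
rewrite prime_coprime // dvdn_prime2 //; apply: contraL Qq' => /eqP <-; exact: PQ.
Qed.

Lemma dvdn_prod_primes y (P : pred nat) q : prime q -> (q <= y)%N -> P q ->
  (q %| \prod_(1 <= q < y.+1 | prime q && P q) q)%N.
Proof.
move=> q_pr q_y Pq; rewrite -big_filter (bigD1_seq q) /=; first exact: dvdn_mulr.
- by rewrite mem_filter q_pr Pq mem_index_iota prime_gt0 // ltnS.
by rewrite filter_uniq ?iota_uniq.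
Qed.

Lemma modn_dvd_eq d m a b : (d %| m)%N -> a = b %[mod m] -> a = b %[mod d].
Proof. by move=> d_m ab; rewrite -(modn_dvdm a d_m) ab modn_dvdm. Qed.

(** The class is -1 modulo the product [M1] of the selected primes and 1 modulo the product [M2] of
    the others. A prime dividing both [M2] and p + 1 would divide 2, which is selected. *)
Lemma exists_sieving_class y (P : pred nat) : P 2%N -> (1 < y)%N -> exists M a,
  [/\ (1 < M)%N, coprime M a, (forall q, prime q -> (y < q)%N -> coprime M q) &
    forall p, p = a %[mod M] -> forall q, prime q -> (q <= y)%N -> (q %| p.+1)%N = P q].
Proof.
move=> P2 y_gt1.
pose M1 := (\prod_(1 <= q < y.+1 | prime q && P q) q)%N.
pose M2 := (\prod_(1 <= q < y.+1 | prime q && ~~ P q) q)%N.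
have co12 : coprime M1 M2 by apply: coprime_prod_primes => q Pq; rewrite negbK.
have M_gt0 Q : (0 < \prod_(1 <= q < y.+1 | prime q && Q q) q)%N.
  by apply: prodn_cond_gt0 => q /andP[/prime_gt0].
have M1_gt0 : (0 < M1)%N := M_gt0 _; have M2_gt0 : (0 < M2)%N := M_gt0 _.
have M1_ge2 : (1 < M1)%N by apply: dvdn_leq (dvdn_prod_primes _ y_gt1 P2).
have M_co Q q : prime q -> (y < q)%N -> coprime (\prod_(1 <= q < y.+1 | prime q && Q q) q) q.
  move=> q_pr y_q; rewrite big_seq_cond.
  apply: (big_ind (fun n => coprime n q)) => [|m n m_co n_co|q' /andP[q'_y /andP[q'_pr _]]].
  - by rewrite coprime1n.
  - by rewrite coprimeMl m_co.
  rewrite prime_coprime // dvdn_prime2 //; apply: contraTneq y_q => <-.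
  by move: q'_y; rewrite mem_index_iota ltnS -leqNgt => /andP[].
exists (M1 * M2)%N, (chinese M1 M2 M1.-1 1); split.
- by rewrite (leq_trans M1_ge2) // leq_pmulr.
- rewrite coprimeMl -coprime_modr chinese_modl // coprime_modr.
  rewrite -[X in _ && X]coprime_modr chinese_modr // coprime_modr coprimen1 andbT.
  by rewrite -{1}(prednK M1_gt0) coprimeSn.
- by move=> q q_pr y_q; rewrite coprimeMl !M_co.
move=> p p_a q q_pr q_y.
have p_M1 : (M1 %| p.+1)%N.
  rewrite /dvdn -addn1 -modnDml (modn_dvd_eq (dvdn_mulr _ (dvdnn _)) p_a) chinese_modl //.
  by rewrite modnDml addn1 prednK // modnn.
have p_M2 : p = 1 %[mod M2].
  by rewrite (modn_dvd_eq (dvdn_mull _ (dvdnn _)) p_a) chinese_modr.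
have [Pq|nPq] := boolP (P q); first by rewrite (dvdn_trans _ p_M1) // dvdn_prod_primes.
have q_M2 : (q %| M2)%N by apply: dvdn_prod_primes.
apply/negP; rewrite /dvdn -addn1 -modnDml (modn_dvd_eq q_M2 p_M2) modnDml.
rewrite -[_ == _]/(q %| 2)%N dvdn_prime2 // => /eqP q2; by rewrite q2 P2 in nPq.
Qed.

End Density.

(* Density in [0, 1/2]: every point of [0, 1/2] is a limit of ratios
   phi(p+1)/phi(p) with p prime. *)
Theorem theorem2 (R : realType) (x : R) (hx0 : 0 <= x) (hx1 : x <= 2^-1)
  (eps : R) (heps : 0 < eps) :
  exists p : nat, prime p /\ `|totient_ratio R p - x| < eps.
Proof.
have eps4_gt0 : 0 < eps / 4 by rewrite divr_gt0.
have [y0 [j [y0_gt1 y0_j P_x]]] := selected_product_dense hx0 hx1 eps4_gt0.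
pose sel q := (q <= j)%N && ((q == 2%N) || (y0 < q)%N).
(* y >= j puts all selected primes below y, and 1 / y <= eps / 16 is what [exists_shifted_prime]
   asks for at eps / 4. *)
pose y := (j + (Num.trunc (eps / 4 / 4)^-1).+1)%N.
have j_y : (j <= y)%N by rewrite leq_addr.
have y_gt1 : (1 < y)%N by rewrite (leq_trans y0_gt1) // (leq_trans y0_j).
have y_eps : y%:R^-1 <= eps / 4 / 4.
  rewrite invf_ple ?posrE ?divr_gt0 ?ltr0n ?(ltnW y_gt1) // ltW //.
  by rewrite (lt_le_trans (truncnS_gt _)) // ler_nat leq_addl.
have sel2 : sel 2%N by rewrite /sel (leq_trans y0_gt1).
have [M [a [M_gt1 M_a M_y M_P]]] := exists_sieving_class sel2 y_gt1.
have [p [p_pr p_B p_a f_lt]] := exists_shifted_prime (Num.trunc (8 / eps)).+2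
  M_gt1 M_a (ltnW y_gt1) M_y eps4_gt0 y_eps.
exists p; split => //.
have rhoE := totient_prod_primes R (ltn0Sn p).
set f := \sum_(_ <- _ | _) _ in f_lt.
have small_part : \prod_(q <- primes p.+1 | (1 <= q < y.+1)%N) (1 - q%:R^-1)
  = selected_product R y0 j.
  rewrite big_primes_interval // /selected_product.
  rewrite [RHS](big_nat_widen _ _ y.+1) ?ltnS // big_nat_cond [RHS]big_nat_cond.
  apply: eq_bigl => q; rewrite !ltnS; case: (boolP (1 <= q <= y)%N) => //= /andP[_ q_y].
  have [q_pr|] := boolP (prime q) => //=.
  by rewrite (M_P p p_a q q_pr q_y) /sel andbC.
have inv01 q : q \in primes p.+1 -> (y < q)%N -> 0 <= (q%:R^-1 : R) <= 1.
  by rewrite mem_primes => /andP[q_pr _] _; exact: inv_prime_bounds.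
have /andP[] := prod_one_sub_ge inv01.
rewrite -/f; set s := \prod_(_ <- _ | _) _ => s_lb s_le1.
have rho_fact : (totient p.+1)%:R / p.+1%:R = selected_product R y0 j * s.
  rewrite rhoE (bigID (fun q => (1 <= q < y.+1)%N)) /= small_part; congr (_ * _).
  rewrite big_seq_cond [RHS]big_seq_cond; apply: eq_bigl => q; rewrite mem_primes.
  case: (boolP (prime q)) => //= /prime_gt0 ->; by rewrite ltnS -ltnNge.
have /andP[P0 P1] := selected_product_bounds R y0 j.
set P := selected_product R y0 j in P_x rho_fact P0 P1.
have p_ge3 : 3 <= p%:R :> R by rewrite ler_nat (leq_trans _ p_B).
have p_eps : 8 / eps <= p%:R - 1.
  rewrite lerBrDr; apply: (@le_trans _ _ (Num.trunc (8 / eps)).+2%:R);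
    last by rewrite ler_nat ltnW.
  by rewrite -[leRHS]natr1 lerD2r ltW // truncnS_gt.
(* (p + 1) / (p - 1) = 1 + 2 / (p - 1). The distance from x is then made of three errors of at most
   eps / 4 each: P against x, s against 1, and this last term. *)
have ratioE : totient_ratio R p = P * s + P * s * (2 / (p%:R - 1)).
  rewrite -rho_fact /totient_ratio (totient_prime p_pr) -subn1 natrB ?prime_gt0 // -natr1.
  by field; rewrite !lt0r_neq0 //; lra.
have e2 : 2 / (p%:R - 1) <= eps / 4.
  rewrite ler_pdivrMr; last by lra.
  move: p_eps; rewrite ler_pdivrMr //; lra.
have e0 : 0 <= 2 / (p%:R - 1) :> R by rewrite divr_ge0 //; lra.
have f_ge0 : 0 <= f by rewrite sumr_ge0 // => q _; rewrite invr_ge0.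
have s_ge0 : 0 <= s.
  rewrite /s big_seq_cond prodr_ge0 // => q /andP[q_p y_q].
  by case/andP: (inv01 q q_p y_q); rewrite subr_ge0.
have Ps_le1 : P * s <= 1 by rewrite mulr_ile1.
rewrite ratioE; move: P_x; rewrite ler_norml ltr_norml => /andP[h1 h2].
have h3 : P * s <= P by rewrite ler_piMr.
have h4 : P - f <= P * s by nra.
have h5 : P * s * (2 / (p%:R - 1)) <= eps / 4 by nra.
have h6 : 0 <= P * s * (2 / (p%:R - 1)) by rewrite mulr_ge0 // mulr_ge0.
move: h3 h4 h5 h6; set v := P * s * (2 / _); set u := P * s => h3 h4 h5 h6.
by apply/andP; split; lra.
Qed.
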